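(* Assume the following. (1) ($L$-smoothness and lower bound) There is a constant $L>0$ such that for every $k\in\{1,\dots,q\}$ and all $x,x'\in\mathbb{R}^n$, $\|\nabla f_k(x)-\nabla f_k(x')\|\le L\|x-x'\|$; and $F^*:=\inf_{x\in\mathbb{R}^n}F_m(x)\in\mathbb{R}$. (2) (Unbiasedness and bounded gradient) There is a constant $\sigma\ge 0$ such that for every $k\in\{1,\dots,q\}$ and every $x\in\mathbb{R}^n$, $\mathbb{E}_\xi[\nabla g_k(x,\xi)]=\nabla f_k(x)$ and $\mathbb{E}_\xi[\|\nabla g_k(x,\xi)\|^2]\le\sigma^2$. Let $T\ge 1$ be an integer, run the Block-SMOO algorithm for $T$ outer iterations with step size $\alpha_t=1/\sqrt{T}$ for all $t=0,\dots,T-1$, and let the output $\bar{x}$ be sampled uniformly at random from $\{x^{0,0,0},\dots,x^{T-1,0,0}\}$, i.e. $\mathbb{P}(\bar{x}=x^{t,0,0})=\frac1T$ for every $t\in\{0,\dots,T-1\}$ (the random index being independent of the run of the algorithm). Then $$\mathbb{E}\left[\left\|\nabla F_m(\bar{x})\right\|^2\right]\le\frac{2}{\sqrt{T}}\left(\mathbb{E}\left[F_m(x^{0,0,0})-F^*\right]+L\sigma^2p^2\left[s+\frac{L s^3}{3}\right]\right).$$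
   Context: Setting. Let $f_1,\dots,f_q:\mathbb{R}^n\to\mathbb{R}$ be continuously differentiable, $f_k(x)=\mathbb{E}[g_k(x,\xi)]$, where $\xi$ is a random variable and $\nabla g_k(x,\xi)$ is the gradient in $x$ of $g_k$ (the stochastic gradient). $\mathbb{E}_\xi$ denotes expectation with respect to $\xi$ (conditional on everything else), and $\|\cdot\|$ is the Euclidean norm. The variable $x\in\mathbb{R}^n$ is partitioned into $s\ge1$ disjoint blocks $x=(x_1,\dots,x_s)$, with $x_i\in\mathbb{R}^{n_i}$ and $\sum_{i=1}^s n_i=n$; $\nabla_i$ denotes the partial gradient with respect to block $x_i$. Let $m=(m_1,\dots,m_q)\in\mathbb{N}^q$ be a frequency vector of nonnegative integers and $p=\sum_{k=1}^q m_k\ge1$. The weighted-sum function is $F_m(x)=\sum_{k=1}^q\frac{m_k}{p}f_k(x)$. Block-SMOO algorithm. Input: an initial point $x^{0,0,0}\in\mathbb{R}^n$, positive step sizes $\{\alpha_t\}$, $p$ and $m$. For $t=0,\dots,T-1$: choose a permutation $\tau$ of $\{1,\dots,s\}$ (it may depend on $t$). For $i=0,\dots,s-1$: choose a map $\pi:\{0,\dots,p-1\}\to\{1,\dots,q\}$ with $|\pi^{-1}(k)|=m_k$ for all $k$ (it may depend on $t,i$). For $j=0,\dots,p-1$: generate a sample $\xi^{t,i,j}$ and set $$x^{t,i,j+1}_{\tau(i+1)}=x^{t,i,j}_{\tau(i+1)}-\alpha_t\nabla_{\tau(i+1)}g_{\pi(j)}(x^{t,i,j},\xi^{t,i,j}),\qquad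 x^{t,i,j+1}_k=x^{t,i,j}_k\ \text{ for } k\ne\tau(i+1).$$ After the loop over $j$ set $x^{t,i+1,0}=x^{t,i,p}$; after the loop over $i$ set $x^{t+1,0,0}=x^{t,s,0}$ (equal to the last iterate obtained, also denoted $x^{t,s,p}$). Each $\xi^{t,i,j}$ is a fresh sample with the distribution of $\xi$, independent of all random information generated before it (the initial point, all earlier samples, and the current and earlier choices of $\tau$ and $\pi$). *)

(* Defs.v *)
From HB Require Import structures.
From mathcomp Require Import all_boot all_order all_fingroup all_algebra.
From mathcomp Require Import all_classical all_reals all_analysis.

Set Implicit Arguments.
Unset Strict Implicit.
Unset Printing Implicit Defensive.

Import Order.TTheory GRing.Theory Num.Theory.
Import numFieldNormedType.Exports.

Local Open Scope classical_set_scope.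
Local Open Scope ring_scope.

(* The norm `|v| provided by the library on 'rV[R]_n is the sup norm. *)
Definition enorm (R : realType) (n : nat) (v : 'rV[R]_n) : R :=
  Num.sqrt (\sum_c (v 0 c) ^+ 2).

Definition grad (R : realType) (n : nat) (h : 'rV[R]_n -> R) (x : 'rV[R]_n) :
    'rV[R]_n :=
  \row_c 'D_(delta_mx 0 c) h x.

Definition continuously_differentiable (R : realType) (n : nat)
    (h : 'rV[R]_n -> R) : Prop :=
  (forall x, differentiable h x) /\ continuous (grad h).

Definition weighted_sum (R : realType) (n q : nat) (m : 'I_q -> nat)
    (f : 'I_q -> 'rV[R]_n -> R) (x : 'rV[R]_n) : R :=
  \sum_k (m k)%:R / (\sum_k m k)%N%:R * f k x.

(* One trajectory of Block-SMOO.  The partition of the variable into s blocks is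
   given by blk, which sends a coordinate to the index of its block; blocks, the
   permutations and the objectives are indexed from 0, so that tau t i stands
   for tau(i+1).  xs t i j is the iterate x^{t,i,j}. *)
Record block_smoo_run (R : realType) (n q s p T : nat) (Xi : Type)
    (g : 'I_q -> 'rV[R]_n -> Xi -> R) (blk : 'I_n -> 'I_s)
    (alpha : 'I_T -> R) (m : 'I_q -> nat)
    (tau : 'I_T -> {perm 'I_s}) (sel : 'I_T -> 'I_s -> {ffun 'I_p -> 'I_q})
    (xi : 'I_T -> 'I_s -> 'I_p -> Xi)
    (xs : nat -> nat -> nat -> 'rV[R]_n) : Prop := BlockSmooRun {
  run_frequency : forall (t : 'I_T) (i : 'I_s) (k : 'I_q),
    #|[pred j | sel t i j == k]| = m k ;
  run_update : forall (t : 'I_T) (i : 'I_s) (j : 'I_p) (c : 'I_n),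
    xs t i j.+1 0 c =
      if blk c == tau t i then
        xs t i j 0 c
          - alpha t * grad (g (sel t i j) ^~ (xi t i j)) (xs t i j) 0 c
      else xs t i j 0 c ;
  run_next_block : forall (t : 'I_T) (i : 'I_s), xs t i.+1 0%N = xs t i p ;
  run_next_iter : forall t : 'I_T, xs t.+1 0%N 0%N = xs t s 0%N
}.

(* The sigma-algebra generated by the initial point x0, the samples whose index
   satisfies Dxi, and the choices of tau and of sel whose index satisfies Dtau
   and Dsel.  The Borel sigma-algebra of 'rV[R]_n is generated by the
   coordinates; the finite types of tau and sel carry the discrete one. *)
Definition run_info (R : realType) (n q s p T : nat) (d d' : measure_display)
    (Omega : measurableType d) (Xi : measurableType d')
    (x0 : Omega -> 'rV[R]_n) (xi : 'I_T -> 'I_s -> 'I_p -> Omega -> Xi)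
    (tau : 'I_T -> Omega -> {perm 'I_s})
    (sel : 'I_T -> 'I_s -> Omega -> {ffun 'I_p -> 'I_q})
    (Dxi : set ('I_T * 'I_s * 'I_p)) (Dtau : set 'I_T)
    (Dsel : set ('I_T * 'I_s)) : set (set Omega) :=
  <<s \bigcup_(c in [set: 'I_n])
        preimage_set_system setT (fun w => x0 w 0 c) measurable
      `|` \bigcup_(a in Dxi)
        preimage_set_system setT (xi a.1.1 a.1.2 a.2) measurable
      `|` \bigcup_(t in Dtau) preimage_set_system setT (tau t) setT
      `|` \bigcup_(a in Dsel) preimage_set_system setT (sel a.1 a.2) setT >>.

Definition sample_before (T s p : nat) (a b : 'I_T * 'I_s * 'I_p) : Prop :=
  (a.1.1 < b.1.1)%N \/
  a.1.1 = b.1.1 /\ ((a.1.2 < b.1.2)%N \/ a.1.2 = b.1.2 /\ (a.2 < b.2)%N).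

Definition independent (R : realType) (d : measure_display)
    (Omega : measurableType d) (P : probability Omega R)
    (G H : set (set Omega)) : Prop :=
  forall A B, G A -> H B -> P (A `&` B) = (P A * P B)%E.

(* The random data of a run: measurability of the initial point and of the
   choices of tau and sel, and, for every (t, i, j), the sample xi t i j has
   law mu and is independent of everything generated before it (the choices of
   tau up to iteration t and of sel up to (t, i) included, so that these choices
   may be random and depend on the past). *)
Record random_run_data (R : realType) (n q s p T : nat)
    (d d' : measure_display) (Omega : measurableType d)
    (P : probability Omega R) (Xi : measurableType d') (mu : probability Xi R)
    (x0 : Omega -> 'rV[R]_n)
    (xi : 'I_T -> 'I_s -> 'I_p -> {mfun Omega >-> Xi})
    (tau : 'I_T -> Omega -> {perm 'I_s})
    (sel : 'I_T -> 'I_s -> Omega -> {ffun 'I_p -> 'I_q}) : Prop :=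
  RandomRunData {
  init_measurable : forall c, measurable_fun setT (fun w => x0 w 0 c) ;
  tau_measurable : forall t u, measurable (tau t @^-1` [set u]) ;
  sel_measurable : forall t i u, measurable (sel t i @^-1` [set u]) ;
  sample_law : forall t i j (B : set Xi),
    measurable B -> distribution P (xi t i j) B = mu B ;
  sample_fresh : forall t i j,
    independent P
      (run_info x0 xi tau sel [set a | sample_before a (t, i, j)]
        [set t' : 'I_T | (t' <= t)%N]
        [set a : 'I_T * 'I_s | (a.1 < t)%N \/ a.1 = t /\ (a.2 <= i)%N])
      (preimage_set_system setT (xi t i j) measurable)
}.

(* The output index: uniform on {0, ..., T-1} and independent of the run. *)
Record uniform_output_index (R : realType) (n q s p T : nat)
    (d d' : measure_display) (Omega : measurableType d)
    (P : probability Omega R) (Xi : measurableType d')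
    (x0 : Omega -> 'rV[R]_n)
    (xi : 'I_T -> 'I_s -> 'I_p -> {mfun Omega >-> Xi})
    (tau : 'I_T -> Omega -> {perm 'I_s})
    (sel : 'I_T -> 'I_s -> Omega -> {ffun 'I_p -> 'I_q})
    (tbar : Omega -> 'I_T) : Prop := UniformOutputIndex {
  index_measurable : forall t, measurable (tbar @^-1` [set t]) ;
  index_uniform : forall t, P (tbar @^-1` [set t]) = (T%:R^-1)%:E ;
  index_independent :
    independent P (run_info x0 xi tau sel setT setT setT)
      (preimage_set_system setT tbar setT)
}.

(* Main.v *)
(** Write x_t for x^{t,0,0}, F for F_m and G_ij for the stochastic gradient used at step (i, j) of
    outer iteration t.  The descent lemma for the L-smooth F gives
    F(x_{t+1}) <= F(x_t) + <grad F(x_t), x_{t+1} - x_t> + L/2 |x_{t+1} - x_t|^2.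
    Distinct inner loops move distinct blocks, so squared displacements add up over the blocks,
    and Cauchy-Schwarz within a block costs a factor p.  In the linear term each G_ij is
    split into the gradient of f_pi(j) at x_t, which sums to p grad F(x_t) by the frequency condition,
    the drift of that gradient (absorbed by Young's inequality and L-smoothness), and
    the noise, whose mean vanishes since the sample is independent of the past.  All of this
    except the two expectation bounds E |G_ij|^2 <= sigma^2 and E noise = 0 is pointwise, so the
    telescoped sum over t is pointwise too and expectations are taken once, at the end. *)

Require Import Defs.
From HB Require Import structures.
From mathcomp Require Import all_boot all_order all_fingroup all_algebra.
From mathcomp Require Import all_classical all_reals all_analysis.
From mathcomp Require Import measurable_realfun ring lra.

Set Implicit Arguments.
Unset Strict Implicit.
Unset Printing Implicit Defensive.

Import Order.TTheory GRing.Theory Num.Theory.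
Import numFieldNormedType.Exports.

Local Open Scope classical_set_scope.
Local Open Scope ring_scope.

(** * Integrating out an independent sample *)

Section frozen_expectation.
Local Open Scope ereal_scope.
Context (R : realType) (d d0 d1 : measure_display) (Omega : measurableType d)
  (P : probability Omega R) (W : measurableType d0) (Z : measurableType d1)
  (nu : probability Z R) (phi : {mfun Omega >-> W}) (xi : {mfun Omega >-> Z}).
Hypothesis law_xi : forall B, measurable B -> P (xi @^-1` B) = nu B.
Hypothesis indep : forall A B, measurable A -> measurable B ->
  P (phi @^-1` A `&` xi @^-1` B) = P (phi @^-1` A) * P (xi @^-1` B).

Let measurable_phi_xi : measurable_fun setT (fun w => (phi w, xi w)).
Proof. by apply: measurable_fun_pair; exact: measurable_funP. Qed.

Let phi_xi : {mfun Omega >-> (W * Z)%type} :=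
  HB.pack (fun w => (phi w, xi w)) (isMeasurableFun.Build _ _ _ _ _ measurable_phi_xi).

(** Independence gives agreement of the two measures on measurable rectangles, and these determine a
    product measure. *)
Let joint_law (A : set (W * Z)) : measurable A ->
  (distribution P phi \x nu) A = distribution P phi_xi A.
Proof.
by apply: product_measure_unique => B C mB mC; have := indep mB mC; rewrite law_xi.
Qed.

(** Change of variables to the product law, then Tonelli: in the inner integral [phi w] is
    frozen. *)
Lemma ge0_integral_indep (h : W * Z -> \bar R) :
  measurable_fun setT h -> (forall u, 0 <= h u) ->
  \int[P]_w h (phi w, xi w) = \int[P]_w \int[nu]_z h (phi w, z).
Proof.
move=> mh h0; transitivity (\int[distribution P phi_xi]_u h u).
  by rewrite ge0_integral_distribution.
transitivity (\int[distribution P phi \x nu]_u h u).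
  by apply: eq_measure_integral => A mA _; exact: esym (joint_law mA).
rewrite fubini_tonelli1// ge0_integral_distribution//.
- exact: measurable_fun_fubini_tonelli_F.
- by move=> u; apply: integral_ge0.
Qed.

Lemma integrable_indep (h : W * Z -> \bar R) (C : R) :
  measurable_fun setT h ->
  (forall u, \int[nu]_z `|h (u, z)| <= C%:E) ->
  P.-integrable setT (fun w => h (phi w, xi w)).
Proof.
move=> mh hC; apply/integrableP; split.
  exact: (measurableT_comp mh).
have mah : measurable_fun setT (abse \o h) by exact: measurableT_comp.
rewrite (@ge0_integral_indep (abse \o h))//; last by move=> u; exact: abse_ge0.
apply: (@le_lt_trans _ _ (\int[P]_w (cst C%:E) w)).
  apply: ge0_le_integral => //.
  - by move=> w _; apply: integral_ge0 => z _; exact: abse_ge0.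
  - apply: (measurableT_comp (f := fun u => \int[nu]_z `|h (u, z)|)) => //.
    by apply: (measurable_fun_fubini_tonelli_F (abse \o h)) => // u; exact: abse_ge0.
  - by move=> w _; exact: hC.
by rewrite integral_cst//= probability_setT mule1 ltry.
Qed.

(** For signed [h] Tonelli is replaced by Fubini. The constant [C] only secures integrability; [c]
    is the bound that survives. *)
Lemma integral_indep_le (h : W * Z -> \bar R) (C c : R) :
  measurable_fun setT h ->
  (forall u, \int[nu]_z `|h (u, z)| <= C%:E) ->
  (forall u, \int[nu]_z h (u, z) <= c%:E) ->
  \int[P]_w h (phi w, xi w) <= c%:E.
Proof.
move=> mh hC hc.
have ih : (distribution P phi \x nu).-integrable setT h.
  apply/integrable12ltyP => //.
  apply: (@le_lt_trans _ _ (\int[distribution P phi]_w (cst C%:E) w)).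
    apply: ge0_le_integral => //.
    - by move=> w _; apply: integral_ge0 => z _; exact: abse_ge0.
    - apply: (measurable_fun_fubini_tonelli_F (abse \o h)); first exact: measurableT_comp.
      by move=> u; exact: abse_ge0.
  by rewrite integral_cst//= probability_setT mule1 ltry.
rewrite -(@integral_distribution _ _ _ _ _ P phi_xi h)//; last first.
  exact: (integrable_indep mh hC).
have -> : \int[distribution P phi_xi]_u h u = \int[distribution P phi \x nu]_u h u.
  by apply: eq_measure_integral => A mA _; exact: esym (joint_law mA).
rewrite -integral12_prod_meas1//.
apply: (@le_trans _ _ (\int[distribution P phi]_w (cst c%:E) w)).
  apply: le_integral => //.
  - exact: integrable_fubini_F.
  - exact: finite_measure_integrable_cst.
  - by move=> u _; exact: hc.
by rewrite integral_cst//= probability_setT mule1.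
Qed.

End frozen_expectation.

(** * Upper bounds on expectations *)

(** Integrability is bundled with the bound, so that such statements can be added, summed and scaled
    by non-negative factors without side conditions. *)
Definition mean_le (R : realType) (d : measure_display)
    (Omega : measurableType d) (P : probability Omega R)
    (X : Omega -> R) (c : R) : Prop :=
  P.-integrable setT (EFin \o X) /\ (\int[P]_w (X w)%:E <= c%:E)%E.

Section mean_bounds.
Context (R : realType) (d : measure_display) (Omega : measurableType d)
  (P : probability Omega R).
Implicit Types (X Y : Omega -> R) (a b k : R).

Lemma mean_le_cst k : mean_le P (fun=> k) k.
Proof.
split; first exact: finite_measure_integrable_cst.
by rewrite integral_cst//= probability_setT mule1.
Qed.

Lemma mean_leD X Y a b :
  mean_le P X a -> mean_le P Y b -> mean_le P (fun w => X w + Y w) (a + b).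
Proof.
move=> [iX Xa] [iY Yb]; split.
  by rewrite (_ : EFin \o _ = (EFin \o X) \+ (EFin \o Y))%E//; exact: integrableD.
by under eq_integral do rewrite EFinD; rewrite integralD_EFin// EFinD leeD.
Qed.

Lemma mean_leZ X a k : 0 <= k -> mean_le P X a -> mean_le P (fun w => k * X w) (k * a).
Proof.
move=> k0 [iX Xa]; split.
  by rewrite (_ : EFin \o _ = (fun w => k%:E * (EFin \o X) w))%E//; exact: integrableZl.
under eq_integral do rewrite EFinM.
by rewrite integralZl// EFinM lee_wpmul2l ?lee_fin.
Qed.

Lemma mean_le_sum (I : Type) (r : seq I) (Q : pred I) (X : I -> Omega -> R)
    (a : I -> R) :
  (forall i, Q i -> mean_le P (X i) (a i)) ->
  mean_le P (fun w => \sum_(i <- r | Q i) X i w) (\sum_(i <- r | Q i) a i).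
Proof.
move=> Xa; elim: r => [|i r IH].
  under eq_fun do rewrite big_nil; rewrite big_nil; exact: mean_le_cst.
under eq_fun do rewrite big_cons; rewrite big_cons.
by case: ifP => // Qi; apply: mean_leD => //; exact: Xa.
Qed.

Lemma mean_leW X a b : mean_le P X a -> a <= b -> mean_le P X b.
Proof. by move=> [iX Xa] ab; split => //; rewrite (le_trans Xa)// lee_fin. Qed.

End mean_bounds.

(* The past is Omega itself with the coarser sigma-algebra <<s U>>: in h (u, z) the outcome u stands
   for everything known before the sample is drawn and z for the value of the sample. *)
Section sub_sigma_algebra.
Context (R : realType) (d d1 : measure_display) (Omega : measurableType d)
  (P : probability Omega R) (Z : measurableType d1) (nu : probability Z R)
  (U : set (set Omega)) (xi : {mfun Omega >-> Z}).
Hypothesis U_measurable : U `<=` measurable.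
Hypothesis law_xi : forall B, measurable B -> P (xi @^-1` B) = nu B.
Hypothesis indep : independent P <<s U>> (preimage_set_system setT xi measurable).

Let measurable_inclusion : measurable_fun setT (id : Omega -> g_sigma_algebraType U).
Proof.
move=> _ A mA; rewrite setTI.
by apply: (smallest_sub (@sigma_algebra_measurable _ Omega) U_measurable mA).
Qed.

Let inclusion : {mfun Omega >-> g_sigma_algebraType U} :=
  HB.pack (id : Omega -> g_sigma_algebraType U)
    (isMeasurableFun.Build _ _ _ _ _ measurable_inclusion).

Let indep_inclusion (A : set (g_sigma_algebraType U)) (B : set Z) :
  measurable A -> measurable B ->
  P (inclusion @^-1` A `&` xi @^-1` B) = (P (inclusion @^-1` A) * P (xi @^-1` B))%E.
Proof.
move=> mA mB; apply: indep => //.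
by exists B => //; rewrite setTI.
Qed.

Lemma ge0_integral_frozen (h : g_sigma_algebraType U * Z -> \bar R) :
  measurable_fun setT h -> (forall u, (0 <= h u)%E) ->
  (\int[P]_w h (w, xi w) = \int[P]_w \int[nu]_z h (w, z))%E.
Proof. exact: (ge0_integral_indep law_xi indep_inclusion). Qed.

(** Both integral bounds concern the sample alone, at a fixed past [u]; being uniform in [u], they
    hold for the expectation. *)
Lemma mean_le_frozen (h : g_sigma_algebraType U * Z -> R) (C c : R) :
  measurable_fun setT h ->
  (forall u, \int[nu]_z `|(h (u, z))%:E| <= C%:E)%E ->
  (forall u, \int[nu]_z (h (u, z))%:E <= c%:E)%E ->
  mean_le P (fun w => h (w, xi w)) c.
Proof.
move=> mh hC hc; have mEh : measurable_fun setT (EFin \o h) by exact/measurable_EFinP.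
split.
  exact: (integrable_indep law_xi indep_inclusion mEh hC).
exact: (integral_indep_le law_xi indep_inclusion mEh hC hc).
Qed.

End sub_sigma_algebra.

(** The preimage splits over the finitely many values of [a], and on each piece the index is
    constant. This takes care of random permutations and random choices of objectives. *)
Lemma measurable_fun_finite_choice (R : realType) (d : measure_display)
    (W : measurableType d) (I : finType) (a : W -> I) (F : I -> W -> R) :
  (forall u, measurable (a @^-1` [set u])) ->
  (forall u, measurable_fun setT (F u)) ->
  measurable_fun setT (fun w => F (a w) w).
Proof.
move=> ma mF _ B mB; rewrite setTI.
have -> : (fun w => F (a w) w) @^-1` B =
    \bigcup_(u in [set: I]) (a @^-1` [set u] `&` F u @^-1` B).
  apply/seteqP; split => [w Bw|w [u _ [/= <- //]]].
  by exists (a w).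
apply: fin_bigcup_measurable => // u _; apply: measurableI => //.
by rewrite -[X in measurable X]setTI; exact: mF.
Qed.

(** * Joint measurability of functions continuous in one variable *)

Section caratheodory.
Context (R : realType) (d0 d1 : measure_display) (W : measurableType d0)
  (Z : measurableType d1) (n : nat).
Implicit Types (k : 'rV[R]_n -> Z -> R) (H : W -> 'rV[R]_n).

(* Rounding the first argument to a grid of mesh 1/(N+1) leaves countably many values of it. *)
Let cell (N : nat) (x : 'rV[R]_n) : 'rV[int]_n :=
  \row_c Num.floor (N.+1%:R * x 0 c).

Let corner (N : nat) (r : 'rV[int]_n) : 'rV[R]_n :=
  \row_c ((r 0 c)%:~R / N.+1%:R).

(** Rounding down errs by at most the mesh in each coordinate, and the norm here is the maximum over
    coordinates. *)
Let corner_cell_cvg (x : 'rV[R]_n) : (fun N => corner N (cell N x)) @ \oo --> x.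
Proof.
apply/cvgrPdist_le => e e0; near=> N.
rewrite [leLHS]/Num.norm/= mx_normrE; apply/bigmax_leP; split; first exact: ltW.
move=> [i c] _ /=; rewrite !mxE (ord1 i).
have N0 : (0 < N.+1%:R :> R) by [].
have /andP[h1 h2] := floor_itv (N.+1%:R * x 0 c).
rewrite -(ler_pM2l N0) -{1}(gtr0_norm N0) -normrM mulrBr mulrCA mulfV ?gt_eqF// mulr1.
rewrite ger0_norm ?subr_ge0//; apply: (@le_trans _ _ 1).
  by rewrite lerBlDl ltW//; move: h2; rewrite intrD.
rewrite -ler_pdivrMl// mulr1 ltW//; near: N; exact: (near_infty_natSinv_lt (PosNum e0)).
Unshelve. all: by end_near. Qed.

(** At the rounded point, [k] is a countable gluing of its sections [k (corner N r)], hence jointly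
    measurable. Continuity in the first variable makes these functions converge pointwise to the one
    wanted. *)
Lemma measurable_fun_caratheodory k H :
  (forall z, continuous (k ^~ z)) -> (forall x, measurable_fun setT (k x)) ->
  (forall c, measurable_fun setT (fun w => H w 0 c)) ->
  measurable_fun [set: W * Z] (fun u : W * Z => k (H u.1) u.2).
Proof.
move=> kcont kmeas Hmeas.
apply: (@measurable_fun_cvg _ _ _ _ (fun N (u : W * Z) => k (corner N (cell N (H u.1))) u.2)).
  move=> N _ B mB; rewrite setTI.
  pose A r : set W := [set w | cell N (H w) = r].
  have mA r : measurable (A r).
    have -> : A r = \bigcap_(c in [set: 'I_n])
        (fun w => N.+1%:R * H w 0 c) @^-1` `[(r 0 c)%:~R, (r 0 c + 1)%:~R[.
      apply/seteqP; split => [w /= <- c _|w /= Hw].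
        by rewrite /= in_itv /= !mxE floor_itv.
      apply/rowP => c; rewrite mxE; apply: floor_def.
      by have := Hw c I; rewrite /= in_itv.
    apply: fin_bigcap_measurable => // c _; rewrite -[X in measurable X]setTI.
    by apply: measurable_funM => //; exact: measurable_itv.
  (* The integer vectors [r] are enumerated by [unpickle]; indices that code no vector contribute
     the empty set. *)
  have -> : (fun u : W * Z => k (corner N (cell N (H u.1))) u.2) @^-1` B =
    \bigcup_i (if unpickle i is Some r then A r `*` (k (corner N r) @^-1` B) else set0).
    apply/seteqP; split => [[w z] /= Bk|[w z] [i _]].
      by exists (pickle (cell N (H w))) => //; rewrite pickleK.
    by case: unpickle => [r|//] [/= <-].
  apply: bigcupT_measurable => i; case: unpickle => [r|//].
  apply: measurableX => //; rewrite -[X in measurable X]setTI; exact: kmeas.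
move=> [w z] _ /=.
apply: (@continuous_cvg _ _ _ _ _ _ (k ^~ z)); [exact: kcont|exact: corner_cell_cvg].
Qed.

(** A partial derivative is the limit of difference quotients with increments 1/(N+1), and each
    quotient is jointly measurable by the preceding lemma. *)
Lemma measurable_fun_grad_caratheodory k H (c : 'I_n) :
  (forall z x, differentiable (k ^~ z) x) ->
  (forall x, measurable_fun setT (k x)) ->
  (forall c, measurable_fun setT (fun w => H w 0 c)) ->
  measurable_fun [set: W * Z] (fun u : W * Z => grad (k ^~ u.2) (H u.1) 0 c).
Proof.
move=> kdiff kmeas Hmeas.
have kcont z : continuous (k ^~ z) by move=> x; exact: differentiable_continuous.
apply: (@measurable_fun_cvg _ _ _ _ (fun N (u : W * Z) => (N.+1%:R^-1)^-1 *
    (k (N.+1%:R^-1 *: delta_mx 0 c + H u.1) u.2 - k (H u.1) u.2))).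
  move=> N; apply: measurable_funM => //; apply: measurable_funB.
    apply: (measurable_fun_caratheodory (H := fun w => N.+1%:R^-1 *: delta_mx 0 c + H w)) => // c'.
    by under eq_fun do rewrite !mxE; exact: measurable_funD.
  exact: (measurable_fun_caratheodory (H := H)).
move=> [w z] _; rewrite /grad mxE /=.
have /cvg_ex [l kl] : derivable (k ^~ z) (H w) (delta_mx 0 c) by exact: diff_derivable.
rewrite /derive (cvg_lim _ kl)//.
have /cvgr_dnbhsP := kl; apply; split; last exact: cvg_harmonic.
by move=> N; rewrite invr_eq0.
Qed.

End caratheodory.

(** * Smooth functions *)

Section smooth_functions.
Context (R : realType) (n : nat).
Implicit Types (u v x y : 'rV[R]_n) (h : 'rV[R]_n -> R).

Lemma sqr_enorm v : enorm v ^+ 2 = \sum_c v 0 c ^+ 2.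
Proof. by rewrite sqr_sqrtr// sumr_ge0// => c _; exact: sqr_ge0. Qed.

Lemma derive_grad h x v : differentiable h x ->
  'D_v h x = \sum_c grad h x 0 c * v 0 c.
Proof.
move=> dh; rewrite deriveE// {1}(row_sum_delta v) linear_sum.
by apply: eq_bigr => c _; rewrite linearZ /= mxE deriveE// mulrC.
Qed.

(** Chain rule along a line: the difference quotients of the restriction at [s] are those of [h] in
    direction [v]. *)
Lemma is_derive_line h x v (s : R) : differentiable h (s *: v + x) ->
  is_derive s (1 : R) (fun s : R => h (s *: v + x))
    (\sum_c grad h (s *: v + x) 0 c * v 0 c).
Proof.
move=> dh; have E : (fun t : R => t^-1 *: ((((fun s : R => h (s *: v + x)) \o shift s) (t *: 1))
      - h (s *: v + x))) =
    (fun t : R => t^-1 *: (((h \o shift (s *: v + x)) (t *: v)) - h (s *: v + x))).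
  apply/funext => t /=; have -> : t *: (1 : R) = t by exact: mulr1.
  by rewrite scalerDl addrA.
by split; rewrite -?derive_grad// /derivable /derive E//; exact: diff_derivable.
Qed.

(** Expanding the square of u - a v gives 2a <u, v> <= |u|^2 + a^2 |v|^2 <= 2 a^2 |v|^2. Dividing by
    2a requires a > 0; for a = 0 the vector [u] vanishes. *)
Lemma cross_term_le u v (a : R) : 0 <= a -> enorm u <= a * enorm v ->
  \sum_c u 0 c * v 0 c <= a * enorm v ^+ 2.
Proof.
move=> a0 uav.
have E0 w : 0 <= enorm w by exact: sqrtr_ge0.
have u2 : enorm u ^+ 2 <= a ^+ 2 * enorm v ^+ 2.
  by rewrite -exprMn lerXn2r ?nnegrE ?mulr_ge0 ?E0.
have [a_eq0|aneq0] := eqVneq a 0.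
  rewrite a_eq0 mul0r big1// => c _.
  have : \sum_c u 0 c ^+ 2 = 0.
    apply/eqP; rewrite -sqr_enorm eq_le sqr_ge0 andbT.
    by rewrite (le_trans u2)// a_eq0 expr0n mul0r.
  move/psumr_eq0P => /(_ (fun c _ => sqr_ge0 _)) /(_ c isT) /eqP.
  by rewrite sqrf_eq0 => /eqP ->; rewrite mul0r.
have apos : 0 < a by rewrite lt_def aneq0.
have a2 : 0 < 2 * a by rewrite mulr_gt0.
rewrite -(ler_pM2l a2).
apply: (@le_trans _ _ (enorm u ^+ 2 + a ^+ 2 * enorm v ^+ 2)).
  rewrite !sqr_enorm !mulr_sumr -big_split /=; apply: ler_sum => c _.
  by have := sqr_ge0 (u 0 c - a * v 0 c); nra.
by lra.
Qed.

Lemma descent h (L : R) x y : 0 <= L -> (forall x, differentiable h x) ->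
  (forall x x', enorm (grad h x - grad h x') <= L * enorm (x - x')) ->
  h y <= h x + \sum_c grad h x 0 c * (y - x) 0 c + L / 2 * enorm (y - x) ^+ 2.
Proof.
move=> L0 dh Lh; set v := y - x; set a := \sum_c _.
(* [psi] is [h] along the segment minus the claimed quadratic majorant, up to the constant [h x].
   Smoothness makes its derivative non-positive on [0, 1], and the claim is psi(1) <= psi(0). *)
pose psi s : R := h (s *: v + x) - (s * a + L / 2 * enorm v ^+ 2 * s ^+ 2).
have dpsi s : is_derive s (1 : R) psi
    (\sum_c grad h (s *: v + x) 0 c * v 0 c - (a + L * s * enorm v ^+ 2)).
  have := is_derive_line (dh (s *: v + x)) => hl.
  apply: is_derive_eq.
  rewrite /= !scaler0 /GRing.scale /=.
  lra.
have : psi 1 <= psi 0.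
  apply: (@ler0_derive1_nincr _ _ 0 1) => //.
  - move=> s; rewrite in_itv /= => /andP[s0 _].
    rewrite derive1E (@derive_val _ _ _ _ _ _ _ (dpsi s)) opprD addrA subr_le0.
    rewrite /a -sumrB.
    under eq_bigr do rewrite -mulrBl.
    have := @cross_term_le (grad h (s *: v + x) - grad h x) v (L * s).
    under [X in _ -> _ -> X <= _]eq_bigr do rewrite !mxE.
    move=> H.
    under eq_bigr do rewrite !mxE.
    apply: H; first by rewrite mulr_ge0// ltW.
    apply: le_trans (Lh _ _) _; rewrite addrK -mulrA ler_wpM2l//.
    rewrite /enorm; under eq_bigr do rewrite mxE exprMn.
    by rewrite -mulr_sumr sqrtrM ?sqr_ge0// sqrtr_sqr gtr0_norm.
  - apply: derivable_within_continuous => s _; exact: (@ex_derive _ _ _ _ _ _ _ (dpsi s)).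
rewrite /psi !scale1r scale0r add0r /v subrK -/v.
lra.
Qed.

End smooth_functions.

(** * Finite sums: squares, blocks and frequencies *)

Section finite_sums.
Context (R : realType).

(** Cauchy-Schwarz against the constant 1. In the induction each cross term with the new summand is
    bounded by 2 b_j b_i <= b_j^2 + b_i^2. *)
Lemma sqr_sum_le (I : Type) (r : seq I) (Q : pred I) (b : I -> R) :
  (\sum_(j <- r | Q j) b j) ^+ 2 <= (count Q r)%:R * \sum_(j <- r | Q j) b j ^+ 2.
Proof.
elim: r => [|j r IH]; first by rewrite !big_nil mulr0 expr0n.
rewrite !big_cons /=; case: ifP => // Qj; rewrite natrD.
set S := \sum_(j <- r | Q j) b j in IH *; set T := \sum_(j <- r | Q j) _ in IH *.
have : 2 * b j * S <= (count Q r)%:R * b j ^+ 2 + T.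
  rewrite /S /T mulr_sumr -sum1_count natr_sum mulr_suml -big_split /=.
  by apply: ler_sum => i _; have := sqr_ge0 (b j - b i); nra.
rewrite (_ : true%:R = 1 :> R)// => H.
rewrite sqrrD mulrDl mul1r mulrDr.
by move: IH H; set C := _%:R; set x := S ^+ 2; set y := b j ^+ 2; lra.
Qed.

Lemma sqr_sum_ord_le (p j0 : nat) (b : 'I_p -> R) : (j0 <= p)%N ->
  (\sum_(j < p | (j < j0)%N) b j) ^+ 2 <= j0%:R * \sum_(j < p | (j < j0)%N) b j ^+ 2.
Proof.
move=> j0p; apply: le_trans (sqr_sum_le _ _ _) _.
by rewrite -sum1_count -(big_ord_widen p (fun=> 1%N))// sum1_card card_ord.
Qed.

(** All cross terms vanish. At a fixed coordinate the moves made in distinct inner loops have this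
    property. *)
Lemma sqr_sum_exclusive (I : finType) (Q : pred I) (a : I -> R) :
  (forall i1 i2, i1 != i2 -> a i1 * a i2 = 0) ->
  (\sum_(i | Q i) a i) ^+ 2 = \sum_(i | Q i) a i ^+ 2.
Proof.
move=> a0; rewrite expr2 mulr_suml; apply: eq_bigr => i Qi.
rewrite mulr_sumr (bigD1 i)//= big1 ?addr0// => i2 /andP[_ ne].
by rewrite a0// eq_sym.
Qed.

Lemma sum_ord_ltS (p : nat) (j : 'I_p) (b : 'I_p -> R) :
  \sum_(j' < p | (j' < j.+1)%N) b j' = \sum_(j' < p | (j' < j)%N) b j' + b j.
Proof.
rewrite (bigD1 j)//= addrC; congr (_ + _); apply: eq_bigl => j'.
by rewrite ltnS -val_eqE /= ltn_neqAle andbC.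
Qed.

Lemma sum_ord_lt0 (p : nat) (b : 'I_p -> R) : \sum_(j' < p | (j' < 0)%N) b j' = 0.
Proof. by rewrite big_pred0. Qed.

Lemma sum_ord_ltn (p : nat) (b : 'I_p -> R) :
  \sum_(j' < p | (j' < p)%N) b j' = \sum_j b j.
Proof. by apply: eq_bigl => j; rewrite ltn_ord. Qed.

(** Every coordinate lies in exactly one block, and [tau] merely reorders the blocks. *)
Lemma sum_blocks (s n : nat) (blk : 'I_n -> 'I_s) (tau : {perm 'I_s}) (b : 'I_n -> R) :
  \sum_i \sum_(c | blk c == tau i) b c = \sum_c b c.
Proof.
by rewrite [RHS](partition_big blk xpredT)//= [RHS](reindex_perm tau).
Qed.

Lemma sum_frequency (p q : nat) (sel : 'I_p -> 'I_q) (m : 'I_q -> nat) (b : 'I_q -> R) :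
  (forall k, #|[pred j | sel j == k]| = m k) ->
  \sum_j b (sel j) = \sum_k (m k)%:R * b k.
Proof.
move=> selm; rewrite (partition_big sel xpredT)//=; apply: eq_bigr => k _.
rewrite (eq_bigr (fun=> b k)) => [|j /eqP ->//].
by rewrite sumr_const -selm mulr_natl.
Qed.

End finite_sums.

(** * Sums of powers of the loop indices *)

Section power_sums.
Context (R : realType).

Lemma sum_const_lt (p j : nat) (c : R) : (j <= p)%N ->
  \sum_(j' < p | (j' < j)%N) c = j%:R * c.
Proof.
by move=> jp; rewrite -(big_ord_widen p (fun=> c))// sumr_const card_ord mulr_natl.
Qed.

Lemma sum_natr (s : nat) : \sum_(i < s) i%:R = s%:R * (s%:R - 1) / 2 :> R.
Proof.
elim: s => [|s IH]; first by rewrite big_ord0 mul0r mul0r.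
by rewrite big_ord_recr /= IH -natr1; field.
Qed.

Lemma sum_sqr_natr_le (p : nat) : \sum_(j < p) j%:R ^+ 2 <= p%:R ^+ 3 / 3 :> R.
Proof.
elim: p => [|p IH]; first by rewrite big_ord0 expr0n mul0r.
rewrite big_ord_recr /= -natr1.
have p0 : 0 <= p%:R :> R by [].
move: IH; set S := \sum_(i < p) _; set x := p%:R in p0 *; move=> IH.
have : (x + 1) ^+ 3 / 3 = x ^+ 3 / 3 + x ^+ 2 + x + 1 / 3 by field.
lra.
Qed.

(** The left side is v times p^3 (sum of i) + s (sum of j^2), hence at most p^3 (s(s-1)/2 + s/3) v;
    for s >= 1 the bracket is at most 2/3 s^3. This constant becomes the s^3/3 of the theorem. *)
Lemma sum_displacement_le (s p : nat) (v : R) : (1 <= s)%N -> 0 <= v ->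
  \sum_(i < s) \sum_(j < p)
    (p%:R * \sum_(i' < s | (i' < i)%N) \sum_(j' < p) v
     + j%:R * \sum_(j' < p | (j' < j)%N) v)
  <= 2 / 3 * p%:R ^+ 3 * s%:R ^+ 3 * v.
Proof.
move=> s1 v0.
rewrite (_ : \sum_(i < s) _ =
    (p%:R ^+ 3 * \sum_(i < s) i%:R + s%:R * \sum_(j < p) j%:R ^+ 2) * v); last first.
  under eq_bigr => i _.
    rewrite sum_const_lt; last exact: ltnW.
    rewrite sumr_const card_ord.
    under eq_bigr => j _ do
      rewrite (sum_const_lt _ (ltnW (ltn_ord j))) [j%:R * (_ * _)]mulrA -expr2.
    rewrite big_split /= sumr_const card_ord -mulr_suml.
    over.
  rewrite big_split /= sumr_const card_ord [RHS]mulrDl; congr (_ + _).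
    rewrite mulr_sumr mulr_suml; apply: eq_bigr => i _.
    by rewrite -(mulr_natl _ p) -(mulr_natl _ p); ring.
  by rewrite -mulrnAl mulr_natl.
rewrite ler_wpM2r// sum_natr.
have s1R : 1 <= s%:R :> R by rewrite ler1n.
have p0 : 0 <= p%:R ^+ 3 :> R by rewrite exprn_ge0.
have := @sum_sqr_natr_le p.
set S := \sum_(j < p) _; set x := s%:R in s1R *; set y := p%:R ^+ 3 in p0 *; move=> SS.
have h1 : x * S <= x * (y / 3) by rewrite ler_wpM2l//; lra.
apply: (@le_trans _ _ (y * (x * (x - 1) / 2) + x * (y / 3))); first by rewrite lerD2l.
have h2 : 0 <= 2 / 3 * x ^+ 3 - (x * (x - 1) / 2 + x / 3) by nra.
by have := mulr_ge0 p0 h2; lra.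
Qed.

End power_sums.

(** * One outer iteration, pointwise *)

Section weighted_sums.
Context (R : realType) (n q : nat) (f : 'I_q -> 'rV[R]_n -> R) (m : 'I_q -> nat).
Hypothesis f_diff : forall k x, differentiable (f k) x.

Lemma weighted_sumE :
  weighted_sum m f = \sum_k ((m k)%:R / (\sum_k m k)%N%:R) *: f k.
Proof. by apply/funext => x; rewrite /weighted_sum fct_sumE. Qed.

Lemma grad_weighted_sum x c : grad (weighted_sum m f) x 0 c =
  \sum_k (m k)%:R / (\sum_k m k)%N%:R * grad (f k) x 0 c.
Proof.
rewrite mxE weighted_sumE derive_sum => [|k].
  apply: eq_bigr => k _; rewrite deriveZ ?mxE//; exact: diff_derivable.
by apply: derivableZ; exact: diff_derivable.
Qed.

Hypothesis sum_m : (0 < \sum_k m k)%N.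

Lemma sum_weights : \sum_k (m k)%:R / (\sum_k m k)%N%:R = 1 :> R.
Proof. by rewrite -mulr_suml -natr_sum divff// pnatr_eq0 -lt0n. Qed.

(** The descent inequalities of the [f k] are averaged. The weights are non-negative and sum to 1,
    so the quadratic term is unchanged. *)
Lemma descent_weighted_sum (L : R) x y : 0 <= L ->
  (forall k x x', enorm (grad (f k) x - grad (f k) x') <= L * enorm (x - x')) ->
  weighted_sum m f y <= weighted_sum m f x +
    \sum_c grad (weighted_sum m f) x 0 c * (y - x) 0 c + L / 2 * enorm (y - x) ^+ 2.
Proof.
move=> L0 fL.
under [X in _ <= _ + X + _]eq_bigr do rewrite grad_weighted_sum mulr_suml.
rewrite exchange_big /=; set e := L / 2 * _.
have -> : e = \sum_k (m k)%:R / (\sum_k m k)%N%:R * e.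
  by rewrite -mulr_suml sum_weights mul1r.
rewrite -!big_split /=; apply: ler_sum => k _.
under [X in _ <= _ + X + _]eq_bigr do rewrite -(mulrA (_ / _)).
rewrite -mulr_sumr -!mulrDr ler_wpM2l ?divr_ge0//.
exact: descent.
Qed.

End weighted_sums.

Section block_iteration.
Context (R : realType) (n q s p : nat) (f : 'I_q -> 'rV[R]_n -> R) (L alpha : R)
  (blk : 'I_n -> 'I_s) (m : 'I_q -> nat) (tau : {perm 'I_s})
  (sel : 'I_s -> 'I_p -> 'I_q) (X : nat -> nat -> 'rV[R]_n)
  (G : 'I_s -> 'I_p -> 'rV[R]_n).
Hypothesis f_diff : forall k x, differentiable (f k) x.
Hypothesis L_ge0 : 0 <= L.
Hypothesis f_smooth : forall k x x',
  enorm (grad (f k) x - grad (f k) x') <= L * enorm (x - x').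
Hypothesis alpha_ge0 : 0 <= alpha.
Hypothesis p_def : p = (\sum_k m k)%N.
Hypothesis p_gt0 : (0 < p)%N.
Hypothesis sel_frequency : forall i k, #|[pred j | sel i j == k]| = m k.
Hypothesis X_update : forall (i : 'I_s) (j : 'I_p) c, X i j.+1 0 c =
  if blk c == tau i then X i j 0 c - alpha * G i j 0 c else X i j 0 c.
Hypothesis X_next : forall i : 'I_s, X i.+1 0%N = X i p.

Let x := X 0 0.

Definition block_sqr (i : 'I_s) (j : 'I_p) : R :=
  \sum_(c | blk c == tau i) G i j 0 c ^+ 2.

(** The noise is paired with the gradient at [x], the start of the outer iteration, which is known
    before the sample is drawn. *)
Definition block_noise (i : 'I_s) (j : 'I_p) : R :=
  \sum_(c | blk c == tau i) grad (weighted_sum m f) x 0 c *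
    (grad (f (sel i j)) (X i j) 0 c - G i j 0 c).

(** Extension by zero outside the active block, so that displacements become plain sums at each
    coordinate. *)
Let masked i j c : R := if blk c == tau i then G i j 0 c else 0.

Let inner_displacement (i : 'I_s) (j : nat) c : (j <= p)%N ->
  X i j 0 c = X i 0 0 c - alpha * \sum_(j' < p | (j' < j)%N) masked i j' c.
Proof.
elim: j => [|j IH] jp; first by rewrite sum_ord_lt0 mulr0 subr0.
rewrite (X_update i (Ordinal jp)) (sum_ord_ltS (Ordinal jp)) /= IH ?(ltnW jp)//.
by rewrite [masked i (Ordinal jp) c]/masked; case: ifP => _; ring.
Qed.

Let outer_displacement (i : nat) c : (i <= s)%N ->
  X i 0 0 c = x 0 c - alpha * \sum_(i' < s | (i' < i)%N) \sum_j masked i' j c.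
Proof.
elim: i => [|i IH] is_; first by rewrite sum_ord_lt0 mulr0 subr0.
rewrite (X_next (Ordinal is_)) inner_displacement// sum_ord_ltn.
by rewrite (sum_ord_ltS (Ordinal is_)) /= IH ?(ltnW is_)//; ring.
Qed.

Let masked_exclusive c i1 i2 j1 j2 : i1 != i2 -> masked i1 j1 c * masked i2 j2 c = 0.
Proof.
move=> ne; rewrite /masked; case: eqP => [e1|_]; last by rewrite mul0r.
case: eqP => [e2|_]; last by rewrite mulr0.
by move: e2; rewrite e1 => /perm_inj e2; rewrite e2 eqxx in ne.
Qed.

Let sum_masked_exclusive c i1 i2 : i1 != i2 ->
  (\sum_j masked i1 j c) * (\sum_j masked i2 j c) = 0.
Proof.
move=> ne; rewrite mulr_suml big1// => j1 _; rewrite mulr_sumr big1// => j2 _.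
exact: masked_exclusive.
Qed.

Let sum_sqr_masked i j : \sum_c masked i j c ^+ 2 = block_sqr i j.
Proof.
rewrite /block_sqr [RHS]big_mkcond; apply: eq_bigr => c _.
by rewrite /masked; case: ifP => _ //; rewrite expr0n.
Qed.

(** Distinct blocks contribute no cross terms, so only Cauchy-Schwarz within one block is paid for,
    with factor p. *)
Let sqr_outer (i : nat) c :
  (\sum_(i' < s | (i' < i)%N) \sum_j masked i' j c) ^+ 2 <=
  p%:R * \sum_(i' < s | (i' < i)%N) \sum_j masked i' j c ^+ 2.
Proof.
rewrite sqr_sum_exclusive; last by move=> *; exact: sum_masked_exclusive.
rewrite mulr_sumr; apply: ler_sum => i' _.
by have := @sqr_sum_ord_le _ p p (fun j => masked i' j c) (leqnn p); rewrite !sum_ord_ltn.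
Qed.

(** A finished block costs the factor p, the block in progress only the number j of steps made so
    far. *)
Lemma sqr_displacement (i : 'I_s) (j : nat) : (j <= p)%N ->
  enorm (X i j - x) ^+ 2 <= alpha ^+ 2 *
    (p%:R * \sum_(i' < s | (i' < i)%N) \sum_j' block_sqr i' j' +
     j%:R * \sum_(j' < p | (j' < j)%N) block_sqr i j').
Proof.
move=> jp; rewrite sqr_enorm.
under [X in _ <= _ * (_ * X + _)]eq_bigr do
  (under eq_bigr do rewrite -sum_sqr_masked; rewrite exchange_big).
rewrite exchange_big /=.
under [X in _ <= _ * (_ + _ * X)]eq_bigr do rewrite -sum_sqr_masked.
rewrite [X in _ <= _ * (_ + _ * X)]exchange_big /= !mulr_sumr -big_split /= mulr_sumr.
apply: ler_sum => c _; rewrite !mxE inner_displacement// outer_displacement ?(ltnW (ltn_ord i))//.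
set S1 := \sum_(i' < s | _) _; set S2 := \sum_(j' < p | _) _.
(* Finished blocks and the current block share no coordinate, so the square of the sum splits. *)
have S12 : S1 * S2 = 0.
  rewrite mulr_suml big1// => i' i'i; rewrite mulr_suml big1// => j1 _.
  rewrite mulr_sumr big1// => j2 _; apply: masked_exclusive.
  by rewrite -val_eqE /= neq_ltn i'i.
rewrite (_ : _ - _ = - (alpha * (S1 + S2))); last by ring.
rewrite sqrrN exprMn ler_wpM2l ?sqr_ge0// sqrrD S12 mul0rn addr0.
by rewrite lerD// ?sqr_outer// sqr_sum_ord_le.
Qed.

Lemma sqr_total_displacement : enorm (X s 0 - x) ^+ 2 <=
  alpha ^+ 2 * (p%:R * \sum_i \sum_j block_sqr i j).
Proof.
rewrite sqr_enorm.
under [X in _ <= _ * (_ * X)]eq_bigr do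
  (under eq_bigr do rewrite -sum_sqr_masked; rewrite exchange_big).
rewrite exchange_big /= !mulr_sumr.
apply: ler_sum => c _; rewrite !mxE outer_displacement//.
rewrite (_ : _ - _ = - (alpha * \sum_(i' < s | (i' < s)%N) \sum_j masked i' j c)); last by ring.
by rewrite sqrrN exprMn ler_wpM2l ?sqr_ge0// (le_trans (sqr_outer _ _))// sum_ord_ltn.
Qed.

Let gF := grad (weighted_sum m f) x.

(** The inner loop uses objective k exactly [m k] times, which is p times its weight in the weighted
    sum. *)
Let sum_objectives c i : \sum_j grad (f (sel i j)) x 0 c = p%:R * gF 0 c.
Proof.
rewrite (sum_frequency (fun k => grad (f k) x 0 c) (@sel_frequency i)).
rewrite /gF grad_weighted_sum// mulr_sumr; apply: eq_bigr => k _.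
by rewrite p_def; field; rewrite -p_def pnatr_eq0 -lt0n.
Qed.

Let progress : \sum_i \sum_j \sum_(c | blk c == tau i) gF 0 c * grad (f (sel i j)) x 0 c
  = p%:R * enorm gF ^+ 2.
Proof.
under eq_bigr do rewrite exchange_big /=.
under eq_bigr => i _ do
  (under eq_bigr do rewrite -mulr_sumr sum_objectives mulrCA -expr2).
by rewrite sum_blocks -mulr_sumr sqr_enorm.
Qed.

(** With u and v the gradients of the chosen objective at [x] and at [X i j], one has -aG = a(v - G)
    - au - a(v - u). Young's inequality bounds the last term by a^2/2 + (v - u)^2/2. *)
Let inner_progress_le (i : 'I_s) (j : 'I_p) :
  - \sum_(c | blk c == tau i) gF 0 c * G i j 0 c <=
  block_noise i j - \sum_(c | blk c == tau i) gF 0 c * grad (f (sel i j)) x 0 c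
  + 1 / 2 * \sum_(c | blk c == tau i) gF 0 c ^+ 2
  + L ^+ 2 / 2 * enorm (X i j - x) ^+ 2.
Proof.
set k := sel i j.
apply: (@le_trans _ _ (block_noise i j - \sum_(c | blk c == tau i) gF 0 c * grad (f k) x 0 c
  + 1 / 2 * \sum_(c | blk c == tau i) gF 0 c ^+ 2
  + 1 / 2 * \sum_(c | blk c == tau i) (grad (f k) (X i j) - grad (f k) x) 0 c ^+ 2)).
  rewrite /block_noise -/gF -/k !mulr_sumr -!sumrN -!big_split /=.
  apply: ler_sum => c _; rewrite [(grad (f k) (X i j) - grad (f k) x) 0 c]mxE.
  rewrite [(- grad (f k) x) 0 c]mxE.
  set a := gF 0 c; set v := grad (f k) (X i j) 0 c; set u := grad (f k) x 0 c.
  by have := sqr_ge0 (a + (v - u)); nra.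
rewrite lerD2l.
(* The drift within the block is enlarged to the full norm, to which L-smoothness applies. *)
suff : enorm (grad (f k) (X i j) - grad (f k) x) ^+ 2 <= L ^+ 2 * enorm (X i j - x) ^+ 2.
  rewrite sqr_enorm (bigID (fun c => blk c == tau i)) /=.
  set S := \sum_(c | blk c != tau i) _.
  have S0 : 0 <= S by apply: sumr_ge0 => c _; exact: sqr_ge0.
  by move: S0; set T := \sum_(c | _) _; set e := enorm (X i j - x); lra.
by rewrite -exprMn lerXn2r ?nnegrE ?mulr_ge0 ?sqrtr_ge0.
Qed.

Lemma block_iteration_descent :
  weighted_sum m f (X s 0) + alpha * p%:R / 2 * enorm gF ^+ 2 <=
  weighted_sum m f x + alpha * (\sum_i \sum_j block_noise i j)
  + L / 2 * (alpha ^+ 2 * (p%:R * \sum_i \sum_j block_sqr i j))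
  + alpha ^+ 3 * L ^+ 2 / 2 * (\sum_(i < s) \sum_(j < p)
      (p%:R * (\sum_(i' < s | (i' < i)%N) \sum_j' block_sqr i' j') +
       j%:R * \sum_(j' < p | (j' < j)%N) block_sqr i j')).
Proof.
have sm : (0 < \sum_k m k)%N by rewrite -p_def.
apply: (@le_trans _ _ (weighted_sum m f x + \sum_c gF 0 c * (X s 0 - x) 0 c +
    L / 2 * enorm (X s 0 - x) ^+ 2 + alpha * p%:R / 2 * enorm gF ^+ 2)).
  by rewrite lerD2r; exact: descent_weighted_sum.
have E : \sum_c gF 0 c * (X s 0 - x) 0 c =
    alpha * \sum_i \sum_j - \sum_(c | blk c == tau i) gF 0 c * G i j 0 c.
  transitivity (\sum_c \sum_i \sum_j - alpha * (gF 0 c * masked i j c)).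
    apply: eq_bigr => c _; rewrite !mxE outer_displacement// sum_ord_ltn.
    rewrite (_ : _ - _ = - alpha * \sum_i \sum_j masked i j c); last by ring.
    rewrite mulrCA !mulr_sumr; apply: eq_bigr => i _.
    by rewrite !mulr_sumr.
  rewrite exchange_big mulr_sumr; apply: eq_bigr => i _ /=.
  rewrite exchange_big mulr_sumr; apply: eq_bigr => j _ /=.
  rewrite -mulr_sumr mulNr mulrN; congr (- (_ * _)).
  rewrite [RHS]big_mkcond; apply: eq_bigr => c _.
  by rewrite /masked; case: ifP => _ //; rewrite mulr0.
rewrite E.
(* The progress terms sum to -p |gF|^2. The Young terms, each block being counted p times, give back
   p/2 |gF|^2, so half of the progress remains. *)
have H1 : \sum_i \sum_j - \sum_(c | blk c == tau i) gF 0 c * G i j 0 c <=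
    \sum_i \sum_j block_noise i j - p%:R / 2 * enorm gF ^+ 2 +
    L ^+ 2 / 2 * \sum_(i < s) \sum_(j < p) enorm (X i j - x) ^+ 2.
  apply: (@le_trans _ _ (\sum_i \sum_j (block_noise i j
      - \sum_(c | blk c == tau i) gF 0 c * grad (f (sel i j)) x 0 c
      + 1 / 2 * \sum_(c | blk c == tau i) gF 0 c ^+ 2
      + L ^+ 2 / 2 * enorm (X i j - x) ^+ 2))).
    by apply: ler_sum => i _; apply: ler_sum => j _; exact: inner_progress_le.
  under eq_bigr do rewrite !big_split /= sumrN -!mulr_sumr.
  rewrite !big_split /= sumrN -!mulr_sumr progress.
  under [X in 1 / 2 * X]eq_bigr do rewrite sumr_const card_ord -mulr_natl.
  rewrite -mulr_sumr sum_blocks -sqr_enorm.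
  lra.
have H2 : \sum_(i < s) \sum_(j < p) enorm (X i j - x) ^+ 2 <=
   alpha ^+ 2 * (\sum_(i < s) \sum_(j < p)
      (p%:R * (\sum_(i' < s | (i' < i)%N) \sum_j' block_sqr i' j') +
       j%:R * \sum_(j' < p | (j' < j)%N) block_sqr i j')).
  rewrite mulr_sumr; apply: ler_sum => i _; rewrite mulr_sumr; apply: ler_sum => j _.
  by apply: sqr_displacement; exact: ltnW.
have H3 := sqr_total_displacement.
move: H1 H2 H3; set D := \sum_(i < s) \sum_j (_ + _); set A := _ * \sum_i \sum_j block_sqr i j.
set N := \sum_i \sum_j block_noise i j; set V := \sum_i \sum_j - _.
set Y := \sum_i \sum_j enorm _ ^+ 2; set e := enorm gF ^+ 2; set y := enorm (X s 0 - x) ^+ 2.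
move=> H1 H2 H3.
have {}H1 := ler_wpM2l alpha_ge0 H1.
have {}H3 := ler_wpM2l (divr_ge0 L_ge0 (ler0n R 2)) H3.
have {}H2 := ler_wpM2l (mulr_ge0 alpha_ge0 (divr_ge0 (sqr_ge0 L) (ler0n R 2))) H2.
lra.
Qed.

End block_iteration.

(** * Second moments of the stochastic gradients *)

Section stochastic_gradient.
Context (R : realType) (n q : nat) (d' : measure_display) (Xi : measurableType d')
  (mu : probability Xi R) (f : 'I_q -> 'rV[R]_n -> R)
  (g : 'I_q -> 'rV[R]_n -> Xi -> R) (sigma : R).
Hypothesis g_diff : forall k z x, differentiable (g k ^~ z) x.
Hypothesis g_int : forall k x, mu.-integrable setT (fun z => (g k x z)%:E).
Hypothesis g_unbiased : forall k x c,
  ('E_mu[(fun z => grad (g k ^~ z) x 0 c)%R])%E = (grad (f k) x 0 c)%:E.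
Hypothesis g_bounded : forall k x,
  ('E_mu[(fun z => enorm (grad (g k ^~ z) x) ^+ 2)%R] <= (sigma ^+ 2)%:E)%E.

Lemma g_measurable k x : measurable_fun setT (g k x).
Proof. by apply/measurable_EFinP; exact: (measurable_int _ (g_int k x)). Qed.

(** Joint measurability with a constant first argument, restricted to the diagonal of [Xi * Xi]. *)
Lemma grad_g_measurable k x c : measurable_fun setT (fun z => grad (g k ^~ z) x 0 c).
Proof.
apply: (measurableT_comp (f := fun u : Xi * Xi => grad (g k ^~ u.2) x 0 c)
  (g := fun z => (z, z))).
  apply: (measurable_fun_grad_caratheodory (k := g k) (H := fun=> x)) => // x'.
  exact: g_measurable.
by apply: measurable_fun_pair; exact: measurable_id.
Qed.

Lemma enorm_grad_g_measurable k x :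
  measurable_fun setT (fun z => enorm (grad (g k ^~ z) x) ^+ 2).
Proof.
under eq_fun do rewrite sqr_enorm; apply: measurable_sum => c.
by apply: measurable_funX; exact: grad_g_measurable.
Qed.

Lemma grad_g_mean_sqr k x : mean_le mu (fun z => enorm (grad (g k ^~ z) x) ^+ 2) (sigma ^+ 2).
Proof.
have := g_bounded k x; rewrite unlock => gb; split=> //.
apply/integrableP; split; first exact/measurable_EFinP/enorm_grad_g_measurable.
apply: (@le_lt_trans _ _ (sigma ^+ 2)%:E); last exact: ltry.
by under eq_integral do rewrite /= ger0_norm ?sqr_ge0//.
Qed.

Lemma grad_g_coord_sqr k x c z : (grad (g k ^~ z) x 0 c) ^+ 2 <= enorm (grad (g k ^~ z) x) ^+ 2.
Proof.
rewrite sqr_enorm (bigD1 c)//= lerDl sumr_ge0// => c' _; exact: sqr_ge0.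
Qed.

Let B : R := 1 + sigma ^+ 2.

(** As |t| <= 1 + t^2, it dominates every coordinate of the stochastic gradient, and its mean is at
    most [B]. *)
Let majorant k x z : R := 1 + enorm (grad (g k ^~ z) x) ^+ 2.

Let majorant_mean k x : mean_le mu (majorant k x) B.
Proof.
apply: mean_leD; [exact: mean_le_cst|exact: grad_g_mean_sqr].
Qed.

Let grad_g_le_majorant k x c z : `|grad (g k ^~ z) x 0 c| <= majorant k x z.
Proof.
have := grad_g_coord_sqr k x c z; rewrite /majorant; set a := grad _ _ _ _.
rewrite -[a ^+ 2]real_normK ?num_real//; set b := `|a|.
by have := sqr_ge0 (b - 1); have := sqr_ge0 b; nra.
Qed.

Lemma grad_g_integrable k x c :
  mu.-integrable setT (fun z => (grad (g k ^~ z) x 0 c)%:E).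
Proof.
apply: le_integrable (majorant_mean k x).1 => //.
  exact/measurable_EFinP/grad_g_measurable.
move=> z _; rewrite lee_fin; apply: le_trans (grad_g_le_majorant k x c z) _.
exact: ler_norm.
Qed.

(** Unbiasedness makes this coordinate the mean of a function below the majorant. Uniformity in [x]
    is what the integrability of the noise rests on. *)
Lemma grad_f_bounded k x c : `|grad (f k) x 0 c| <= 1 + sigma ^+ 2.
Proof.
rewrite -lee_fin -abse_EFin -g_unbiased unlock.
apply: le_trans (le_abse_integral _ _ _) _ => //.
  exact/measurable_EFinP/grad_g_measurable.
apply: le_trans _ (majorant_mean k x).2; apply: ge0_le_integral => //.
- apply: measurableT_comp => //; exact/measurable_EFinP/grad_g_measurable.
- apply/measurable_EFinP/measurable_funD => //; exact: enorm_grad_g_measurable.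
- by move=> z _; rewrite lee_fin.
Qed.

Lemma noise_integral k x c (a : R) :
  (\int[mu]_z (a * (grad (f k) x 0 c - grad (g k ^~ z) x 0 c))%:E = 0)%E.
Proof.
pose G z : R := grad (g k ^~ z) x 0 c; set b : R := grad (f k) x 0 c.
have ig : mu.-integrable setT (EFin \o G) by exact: grad_g_integrable.
have ib : mu.-integrable setT (EFin \o cst b).
  exact: finite_measure_integrable_cst.
have Ib : (\int[mu]_z (b%:E) = b%:E)%E.
  by rewrite integral_cst//= probability_setT mule1.
under eq_integral do rewrite EFinM.
rewrite integralZl//; last exact: (integrableB measurableT ib ig).
under eq_integral do rewrite EFinB.
rewrite (integralB _ ib ig)//= Ib.
by have := g_unbiased k x c; rewrite unlock => ->; rewrite subee// mule0.
Qed.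

(** A crude bound, independent of the point; it serves as the constant [C] in [mean_le_frozen]. *)
Lemma noise_integral_abs k x c (a b : R) : `|a| <= b ->
  (\int[mu]_z `|(a * (grad (f k) x 0 c - grad (g k ^~ z) x 0 c))%:E|
    <= (b * (B + B))%:E)%E.
Proof.
move=> ab; have b0 : 0 <= b by exact: le_trans ab.
have B0 : 0 <= B by rewrite addr_ge0// sqr_ge0.
have [_ h] := mean_leZ b0 (mean_leD (mean_le_cst mu B) (majorant_mean k x)).
apply: le_trans _ h; apply: ge0_le_integral => //.
- apply: measurableT_comp => //; apply/measurable_EFinP/measurable_funM => //.
  by apply: measurable_funB => //; exact: grad_g_measurable.
- apply/measurable_EFinP/measurable_funM => //; apply: measurable_funD => //.
  by apply: measurable_funD => //; exact: enorm_grad_g_measurable.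
move=> z _; rewrite lee_fin normrM ler_pM//.
apply: le_trans (ler_normB _ _) _.
by rewrite lerD ?grad_f_bounded.
Qed.

End stochastic_gradient.

(** * Measurability of the iterates *)

Definition coord_measurable (R : realType) (n : nat) (d : measure_display)
    (W : measurableType d) (y : W -> 'rV[R]_n) : Prop :=
  forall c, measurable_fun setT (fun w => y w 0 c).

(** The joint measurability lemma for a [k] that ignores its second argument, pulled back to the
    diagonal. *)
Lemma continuous_measurable_comp (R : realType) (n : nat) (d : measure_display)
    (W : measurableType d) (h : 'rV[R]_n -> R) (y : W -> 'rV[R]_n) :
  continuous h -> coord_measurable y -> measurable_fun setT (fun w => h (y w)).
Proof.
move=> hcont my.
apply: (measurableT_comp (f := fun u : W * W => h (y u.1)) (g := fun w => (w, w))).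
  exact: (measurable_fun_caratheodory (k := fun x _ => h x) (H := y)).
by apply: measurable_fun_pair; exact: measurable_id.
Qed.

Section iterates_measurable.
Context (R : realType) (n q s p T : nat) (d d' : measure_display)
  (W : measurableType d) (Xi : measurableType d')
  (g : 'I_q -> 'rV[R]_n -> Xi -> R) (blk : 'I_n -> 'I_s) (alpha : 'I_T -> R)
  (m : 'I_q -> nat) (tau : 'I_T -> W -> {perm 'I_s})
  (sel : 'I_T -> 'I_s -> W -> {ffun 'I_p -> 'I_q})
  (xi : 'I_T -> 'I_s -> 'I_p -> W -> Xi)
  (xs : nat -> nat -> nat -> W -> 'rV[R]_n).
Hypothesis g_diff : forall k z x, differentiable (g k ^~ z) x.
Hypothesis g_meas : forall k x, measurable_fun setT (g k x).
Hypothesis run : forall w, block_smoo_run g blk alpha m (tau ^~ w)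
  (fun t i => sel t i w) (fun t i j => xi t i j w) (fun t i j => xs t i j w).


Hypothesis init_meas : coord_measurable (xs 0 0 0).

(** What step (t, i, j) consumes. The sigma-algebra on [W] stays open: it will be the past of a
    sample, the information of the whole run, or the full one on [Omega]. *)
Definition step_measurable (t : 'I_T) (i : 'I_s) (j : 'I_p) : Prop :=
  [/\ forall u, measurable (tau t @^-1` [set u]),
      forall u, measurable (sel t i @^-1` [set u]) &
      measurable_fun setT (xi t i j)].

Let coord_measurable_step (t : 'I_T) (i : 'I_s) (j : 'I_p) : step_measurable t i j ->
  coord_measurable (xs t i j) -> coord_measurable (xs t i j.+1).
Proof.
move=> [mtau msel mxi] mx c.
under eq_fun do rewrite (run_update (run _)).
apply: (measurable_fun_finite_choice (a := tau t) (F := fun u w =>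
  if blk c == u i then xs t i j w 0 c - alpha t *
     grad (g (sel t i w j) ^~ (xi t i j w)) (xs t i j w) 0 c
  else xs t i j w 0 c)) => // u.
rewrite /=; case: (blk c == u i); last exact: mx.
apply: measurable_funB; first exact: mx.
apply: measurable_funM => //.
apply: (measurable_fun_finite_choice (a := sel t i) (F := fun v w =>
  grad (g (v j) ^~ (xi t i j w)) (xs t i j w) 0 c)) => // v.
apply: (measurableT_comp (f := fun u : W * Xi => grad (g (v j) ^~ u.2) (xs t i j u.1) 0 c)
  (g := fun w => (w, xi t i j w))).
  exact: (measurable_fun_grad_caratheodory (k := g (v j)) (H := xs t i j)).
by apply: measurable_fun_pair => //; exact: measurable_id.
Qed.

Let coord_measurable_inner (t : 'I_T) (i : 'I_s) (j0 : nat) : (j0 <= p)%N ->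
  (forall j : 'I_p, (j < j0)%N -> step_measurable t i j) ->
  coord_measurable (xs t i 0) -> coord_measurable (xs t i j0).
Proof.
move=> j0p steps x0; elim: j0 j0p steps => [//|j IH] jp steps.
apply: (coord_measurable_step (j := Ordinal jp)); first exact: steps.
by apply: IH => [|j' j'j]; [exact: ltnW|apply: steps; exact: ltnW].
Qed.

Let coord_measurable_outer (t : 'I_T) (i0 : nat) : (i0 <= s)%N ->
  (forall (i : 'I_s) j, (i < i0)%N -> step_measurable t i j) ->
  coord_measurable (xs t 0 0) -> coord_measurable (xs t i0 0).
Proof.
move=> i0s steps x0; elim: i0 i0s steps => [//|i IH] is_ steps.
rewrite (_ : xs t i.+1 0 = xs t i p); last first.
  by apply/funext => w; exact: (run_next_block (run w) t (Ordinal is_)).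
apply: (coord_measurable_inner (i := Ordinal is_)) => // [j _|]; first exact: steps.
by apply: IH => [|i' j i'i]; [exact: ltnW|apply: steps; exact: ltnW].
Qed.

Let coord_measurable_iter (t0 : nat) : (t0 <= T)%N ->
  (forall (t : 'I_T) i j, (t < t0)%N -> step_measurable t i j) ->
  coord_measurable (xs t0 0 0).
Proof.
elim: t0 => [//|t IH] tT steps.
rewrite (_ : xs t.+1 0 0 = xs t s 0); last first.
  by apply/funext => w; exact: (run_next_iter (run w) (Ordinal tT)).
apply: (coord_measurable_outer (t := Ordinal tT)) => // [i j _|]; first exact: steps.
by apply: IH => [|t' i j t't]; [exact: ltnW|apply: steps; exact: ltnW].
Qed.

(** Only strictly earlier steps enter, so the iterate is measurable for the past of the sample drawn
    at it. *)
Lemma iterate_measurable (t : 'I_T) (i : 'I_s) (j : 'I_p) :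
  (forall t' i' j', sample_before (t', i', j') (t, i, j) -> step_measurable t' i' j') ->
  coord_measurable (xs t i j).
Proof.
move=> steps; apply: coord_measurable_inner; first exact: ltnW.
  by move=> j' j'j; apply: steps; right; split => //; right.
apply: coord_measurable_outer; first exact: ltnW.
  by move=> i' j' i'i; apply: steps; right; split => //; left.
apply: coord_measurable_iter; first exact: ltnW.
by move=> t' i' j' t't; apply: steps; left.
Qed.

Lemma outer_iterate_measurable (t : 'I_T) :
  (forall (t' : 'I_T) i' j', (t' < t)%N -> step_measurable t' i' j') ->
  coord_measurable (xs t 0 0).
Proof. by apply: coord_measurable_iter; exact: ltnW. Qed.

End iterates_measurable.

Lemma measurable_finite_preimage (d : measure_display) (W : measurableType d)
    (I : finType) (a : W -> I) (A : set I) :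
  (forall u, measurable (a @^-1` [set u])) -> measurable (a @^-1` A).
Proof.
move=> ma; have -> : a @^-1` A = \bigcup_(u in A) a @^-1` [set u].
  by apply/seteqP; split => [w Aw|w [u Au /= ->//]]; exists (a w).
by apply: fin_bigcup_measurable => //; exact: sub_finite_set (@subsetT _ A) _.
Qed.

(** * Sigma-algebras generated by the run *)

Section run_measurability.
Context (R : realType) (n q s p T : nat) (d d' : measure_display)
  (Omega : measurableType d) (P : probability Omega R) (Xi : measurableType d')
  (mu : probability Xi R) (x0 : Omega -> 'rV[R]_n)
  (xi : 'I_T -> 'I_s -> 'I_p -> {mfun Omega >-> Xi})
  (tau : 'I_T -> Omega -> {perm 'I_s})
  (sel : 'I_T -> 'I_s -> Omega -> {ffun 'I_p -> 'I_q}).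
Hypothesis run_data : random_run_data P mu x0 xi tau sel.

(** The generating family inside [run_info], named so that [Omega] can be equipped with the
    sigma-algebra it generates. *)
Definition run_generators (Dxi : set ('I_T * 'I_s * 'I_p)) (Dtau : set 'I_T)
    (Dsel : set ('I_T * 'I_s)) : set (set Omega) :=
  \bigcup_(c in [set: 'I_n])
      preimage_set_system setT (fun w => x0 w 0 c) measurable
    `|` \bigcup_(a in Dxi)
      preimage_set_system setT (xi a.1.1 a.1.2 a.2) measurable
    `|` \bigcup_(t in Dtau) preimage_set_system setT (tau t) setT
    `|` \bigcup_(a in Dsel) preimage_set_system setT (sel a.1 a.2) setT.

Lemma run_generators_measurable Dxi Dtau Dsel :
  run_generators Dxi Dtau Dsel `<=` measurable.
Proof.
move=> A [[[]|]|] [a _ [B mB <-]].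
- exact: (init_measurable run_data a).
- exact: measurable_funP.
- by rewrite setTI; apply: measurable_finite_preimage => u; exact: (tau_measurable run_data).
- by rewrite setTI; apply: measurable_finite_preimage => u; exact: (sel_measurable run_data).
Qed.

Lemma init_coord_measurable Dxi Dtau Dsel :
  coord_measurable (W := g_sigma_algebraType (run_generators Dxi Dtau Dsel)) x0.
Proof.
move=> c _ B mB; apply: sub_sigma_algebra; left; left; left.
by exists c => //; exists B.
Qed.

Lemma generators_step_measurable Dxi Dtau Dsel t i j :
  Dxi (t, i, j) -> Dtau t -> Dsel (t, i) ->
  step_measurable (W := g_sigma_algebraType (run_generators Dxi Dtau Dsel))
    tau sel xi t i j.
Proof.
move=> Dxia Dtaua Dsela; split=> [u|u|_ B mB]; apply: sub_sigma_algebra.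
- by left; right; exists t => //; exists [set u] => //; rewrite setTI.
- by right; exists (t, i) => //; exists [set u] => //; rewrite setTI.
- by left; left; right; exists (t, i, j) => //; exists B.
Qed.

End run_measurability.

(** * Expectations along the run *)

Lemma measurable_fst_preimage (d d' : measure_display) (W : measurableType d)
    (Z : measurableType d') (I : Type) (a : W -> I) (u : I) :
  measurable (a @^-1` [set u]) ->
  measurable ((fun w : W * Z => a w.1) @^-1` [set u]).
Proof. by move=> ma; have := @measurable_fst _ _ W Z measurableT _ ma; rewrite setTI. Qed.

Section expected_run.
Context (R : realType) (n q s p T : nat)
  (d d' : measure_display) (Omega : measurableType d) (P : probability Omega R)
  (Xi : measurableType d') (mu : probability Xi R)
  (f : 'I_q -> 'rV[R]_n -> R) (g : 'I_q -> 'rV[R]_n -> Xi -> R)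
  (blk : 'I_n -> 'I_s) (a : R) (m : 'I_q -> nat) (sigma : R)
  (tau : 'I_T -> Omega -> {perm 'I_s})
  (sel : 'I_T -> 'I_s -> Omega -> {ffun 'I_p -> 'I_q})
  (xi : 'I_T -> 'I_s -> 'I_p -> {mfun Omega >-> Xi})
  (xs : nat -> nat -> nat -> Omega -> 'rV[R]_n).
Hypothesis f_C1 : forall k, continuously_differentiable (f k).
Hypothesis g_diff : forall k z x, differentiable (g k ^~ z) x.
Hypothesis g_int : forall k x, mu.-integrable setT (fun z => (g k x z)%:E).
Hypothesis g_unbiased : forall k x c,
  ('E_mu[(fun z => grad (g k ^~ z) x 0 c)%R])%E = (grad (f k) x 0 c)%:E.
Hypothesis g_bounded : forall k x,
  ('E_mu[(fun z => enorm (grad (g k ^~ z) x) ^+ 2)%R] <= (sigma ^+ 2)%:E)%E.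
Hypothesis sum_m : (0 < \sum_k m k)%N.
Hypothesis run_data : random_run_data P mu (xs 0%N 0%N 0%N) xi tau sel.
Hypothesis run : forall w : Omega, block_smoo_run g blk (fun=> a) m
  (tau ^~ w) (fun t i => sel t i w) (fun t i j => xi t i j w) (fun t i j => xs t i j w).

Let gens := run_generators (xs 0 0 0) xi tau sel.

(** Samples are taken strictly before (t, i, j), but [tau t] and [sel t i] are included, being
    chosen before this sample is drawn. *)
Let past (t : 'I_T) (i : 'I_s) (j : 'I_p) : set (set Omega) :=
  gens [set a | sample_before a (t, i, j)] [set t' : 'I_T | (t' <= t)%N]
    [set a : 'I_T * 'I_s | (a.1 < t)%N \/ a.1 = t /\ (a.2 <= i)%N].

Let past_step t i j t' i' j' : sample_before (t', i', j') (t, i, j) ->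
  step_measurable (W := g_sigma_algebraType (past t i j)) tau sel xi t' i' j'.
Proof.
move=> before; apply: generators_step_measurable => //=.
- by case: before => /= [/ltnW//|[->]].
- case: before => /= [|[-> [/ltnW|[-> _]]]]; [by left|by right|by right].
Qed.

Let past_choices t i j :
  (forall u, measurable (tau t @^-1` [set u] : set (g_sigma_algebraType (past t i j)))) /\
  (forall u, measurable (sel t i @^-1` [set u] : set (g_sigma_algebraType (past t i j)))).
Proof.
split=> u; apply: sub_sigma_algebra.
- by left; right; exists t => //=; exists [set u] => //; rewrite setTI.
- by right; exists (t, i) => //=; [right|exists [set u] => //; rewrite setTI].
Qed.

Let past_iterate t i j :
  coord_measurable (W := g_sigma_algebraType (past t i j)) (xs t i j).
Proof.
apply: (iterate_measurable (W := g_sigma_algebraType (past t i j)) (xi := xi) g_diff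
  (g_measurable g_int) run).
  exact: init_coord_measurable.
exact: past_step.
Qed.

Let past_outer_iterate t i j :
  coord_measurable (W := g_sigma_algebraType (past t i j)) (xs t 0 0).
Proof.
apply: (outer_iterate_measurable (W := g_sigma_algebraType (past t i j)) (xi := xi) g_diff
  (g_measurable g_int) run).
  exact: init_coord_measurable.
by move=> t' i' j' t't; apply: past_step; left.
Qed.

Let G t w i j := grad (g (sel t i w j) ^~ (xi t i j w)) (xs t i j w).

(** With the past frozen, this is part of the squared norm of a stochastic gradient at a fixed
    point, so the second-moment bound applies for every past. *)
Lemma mean_block_sqr t i j :
  mean_le P (fun w => block_sqr blk (tau t w) (G t w) i j) (sigma ^+ 2).
Proof.
pose W := g_sigma_algebraType (past t i j).
have [mtau msel] := past_choices t i j.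
pose h (u : W * Xi) := \sum_(c | blk c == tau t u.1 i)
  grad (g (sel t i u.1 j) ^~ u.2) (xs t i j u.1) 0 c ^+ 2.
have h_le u z : `|h (u, z)| <= enorm (grad (g (sel t i u j) ^~ z) (xs t i j u)) ^+ 2.
  rewrite ger0_norm; last by apply: sumr_ge0 => c _; exact: sqr_ge0.
  rewrite sqr_enorm [leRHS](bigID (fun c => blk c == tau t u i))/= lerDl.
  by apply: sumr_ge0 => c _; exact: sqr_ge0.
have mh : measurable_fun setT h.
  apply: (measurable_fun_finite_choice (a := fun u : W * Xi => tau t u.1)
    (F := fun v u => \sum_(c | blk c == v i)
      grad (g (sel t i u.1 j) ^~ u.2) (xs t i j u.1) 0 c ^+ 2)) => v.
    exact: measurable_fst_preimage.
  apply: (measurable_fun_finite_choice (a := fun u : W * Xi => sel t i u.1)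
    (F := fun k u => \sum_(c | blk c == v i)
      grad (g (k j) ^~ u.2) (xs t i j u.1) 0 c ^+ 2)) => k.
    exact: measurable_fst_preimage.
  under eq_fun do rewrite big_mkcond; apply: measurable_sum => c.
  case: (blk c == v i) => //; apply: measurable_funX.
  apply: (measurable_fun_grad_caratheodory (k := g (k j)) (H := xs t i j : W -> _)) => //.
  - exact: g_measurable.
  - exact: past_iterate.
have hC u : (\int[mu]_z `|(h (u, z))%:E| <= (sigma ^+ 2)%:E)%E.
  apply: le_trans _ (grad_g_mean_sqr g_diff g_int g_bounded (sel t i u j) (xs t i j u)).2.
  apply: ge0_le_integral => //.
  - apply: measurableT_comp => //; apply/measurable_EFinP.
    exact: (measurable_fun_pair2 u mh).
  - apply/measurable_EFinP; exact: (enorm_grad_g_measurable g_diff g_int).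
  - by move=> z _; rewrite lee_fin.
apply: (@mean_le_frozen _ _ _ _ _ _ _ (past t i j) _ _ _ _ h _ _ mh hC).
- exact: (run_generators_measurable run_data).
- exact: (sample_law run_data t i j).
- exact: (sample_fresh run_data).
- move=> u; apply: le_trans (lee_abs _) (le_trans (le_abse_integral _ _ _) (hC u)) => //.
  by apply/measurable_EFinP; exact: (measurable_fun_pair2 u mh).
Qed.

Let F := weighted_sum m f.

Let f_diff k x : differentiable (f k) x := (f_C1 k).1 x.

Lemma grad_weighted_sum_bounded x c : `|grad F x 0 c| <= 1 + sigma ^+ 2.
Proof.
rewrite grad_weighted_sum//; set e := 1 + _.
have -> : e = \sum_k (m k)%:R / (\sum_k m k)%N%:R * e.
  by rewrite -mulr_suml sum_weights// mul1r.
apply: le_trans (ler_norm_sum _ _ _) _; apply: ler_sum => k _.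
rewrite normrM ger0_norm ?divr_ge0// ler_wpM2l ?divr_ge0//.
exact: (grad_f_bounded g_diff g_int g_unbiased g_bounded).
Qed.

Lemma continuous_grad_f k c : continuous (fun x => grad (f k) x 0 c).
Proof.
move=> x; apply: (continuous_comp (f := grad (f k)) (g := fun y : 'rV_n => y 0 c)).
  exact: (f_C1 k).2.
exact: coord_continuous.
Qed.

Lemma grad_weighted_sum_measurable (d0 : measure_display) (W : measurableType d0)
    (H : W -> 'rV[R]_n) c :
  coord_measurable H -> measurable_fun setT (fun w => grad F (H w) 0 c).
Proof.
move=> mH; under eq_fun do rewrite grad_weighted_sum//.
apply: measurable_sum => k; apply: measurable_funM => //.
exact: (continuous_measurable_comp (@continuous_grad_f k c) mH).
Qed.

(** Coordinate by coordinate, the noise is a bounded factor [b] determined by the past times a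
    difference whose mean over the sample is zero by unbiasedness. *)
Lemma mean_block_noise t i j : mean_le P (fun w =>
  block_noise f blk m (tau t w) (fun i j => sel t i w j)
    (fun i j => xs t i j w) (G t w) i j) 0.
Proof.
pose W := g_sigma_algebraType (past t i j).
have [mtau msel] := past_choices t i j.
pose b (w : W) c : R := if blk c == tau t w i then grad F (xs t 0 0 w) 0 c else 0.
pose h c (u : W * Xi) : R := b u.1 c *
  (grad (f (sel t i u.1 j)) (xs t i j u.1) 0 c -
   grad (g (sel t i u.1 j) ^~ u.2) (xs t i j u.1) 0 c).
rewrite (_ : (fun w => _) = fun w => \sum_c h c (w, xi t i j w)); last first.
  apply/funext => w; rewrite /block_noise big_mkcond; apply: eq_bigr => c _.
  by rewrite /h /b /=; case: ifP => // _; rewrite mul0r.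
apply: (mean_leW (a := \sum_(c < n) (0 : R))); last by rewrite big1.
apply: mean_le_sum => c _.
have bB u : `|b u c| <= 1 + sigma ^+ 2.
  rewrite /b; case: ifP => _; first exact: grad_weighted_sum_bounded.
  by rewrite normr0 addr_ge0// sqr_ge0.
have mh : measurable_fun setT (h c).
  apply: (measurable_fun_finite_choice (a := fun u : W * Xi => tau t u.1)
    (F := fun v u => (if blk c == v i then grad F (xs t 0 0 u.1) 0 c else 0) *
      (grad (f (sel t i u.1 j)) (xs t i j u.1) 0 c -
       grad (g (sel t i u.1 j) ^~ u.2) (xs t i j u.1) 0 c))) => v.
    exact: measurable_fst_preimage.
  apply: (measurable_fun_finite_choice (a := fun u : W * Xi => sel t i u.1)
    (F := fun k u => (if blk c == v i then grad F (xs t 0 0 u.1) 0 c else 0) *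
      (grad (f (k j)) (xs t i j u.1) 0 c -
       grad (g (k j) ^~ u.2) (xs t i j u.1) 0 c))) => k.
    exact: measurable_fst_preimage.
  apply: measurable_funM.
    case: (blk c == v i) => //.
    apply: (measurableT_comp (f := fun w : W => grad F (xs t 0 0 w) 0 c) (g := fst)).
      by apply: grad_weighted_sum_measurable; exact: past_outer_iterate.
    exact: measurable_fst.
  apply: measurable_funB.
    apply: (measurableT_comp (f := fun w : W => grad (f (k j)) (xs t i j w) 0 c) (g := fst)).
      apply: (continuous_measurable_comp (@continuous_grad_f (k j) c)).
      exact: past_iterate.
    exact: measurable_fst.
  apply: (measurable_fun_grad_caratheodory (k := g (k j)) (H := xs t i j : W -> _)) => //.
  - exact: g_measurable.
  - exact: past_iterate.
have hC u := noise_integral_abs g_diff g_int g_unbiased g_bounded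
  (sel t i u j) (xs t i j u) c (bB u).
apply: (@mean_le_frozen _ _ _ _ _ _ _ (past t i j) _ _ _ _ (h c) _ _ mh hC).
- exact: (run_generators_measurable run_data).
- exact: (sample_law run_data t i j).
- exact: (sample_fresh run_data).
- move=> u; rewrite [leLHS](_ : _ = 0%E)//.
  exact: (noise_integral g_diff g_int g_unbiased g_bounded (sel t i u j) (xs t i j u) c (b u c)).
Qed.

(** * Mean error of an iteration, telescoping and the output index *)

Context (L : R).
Hypothesis s_ge1 : (1 <= s)%N.
Hypothesis p_def : p = (\sum_k m k)%N.
Hypothesis L_ge0 : 0 <= L.
Hypothesis f_smooth : forall k x x',
  enorm (grad (f k) x - grad (f k) x') <= L * enorm (x - x').
Hypothesis F_lbound : has_lbound (range F).
Hypothesis a_ge0 : 0 <= a.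

Let sqr_grad t w := enorm (grad F (xs t 0 0 w)) ^+ 2.

(** The terms that [block_iteration_descent] adds to the value of [F] at the start of iteration
    t. *)
Let iteration_error (t : 'I_T) w :=
  a * (\sum_i \sum_j block_noise f blk m (tau t w) (fun i j => sel t i w j)
    (fun i j => xs t i j w) (G t w) i j)
  + L / 2 * (a ^+ 2 * (p%:R * \sum_i \sum_j block_sqr blk (tau t w) (G t w) i j))
  + a ^+ 3 * L ^+ 2 / 2 * (\sum_(i < s) \sum_(j < p)
    (p%:R * (\sum_(i' < s | (i' < i)%N) \sum_j' block_sqr blk (tau t w) (G t w) i' j') +
     j%:R * \sum_(j' < p | (j' < j)%N) block_sqr blk (tau t w) (G t w) i j')).

Let mean_iteration_error t : mean_le P (iteration_error t)
  (L / 2 * (a ^+ 2 * (p%:R * (s%:R * (p%:R * sigma ^+ 2)))) +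
   a ^+ 3 * L ^+ 2 / 2 * (2 / 3 * p%:R ^+ 3 * s%:R ^+ 3 * sigma ^+ 2)).
Proof.
(* The same expression with each noise replaced by 0 and each [block_sqr] by [sigma ^+ 2]; all
   coefficients are non-negative. *)
apply: (@mean_leW _ _ _ _ _ (a * (\sum_(i < s) \sum_(j < p) 0)
  + L / 2 * (a ^+ 2 * (p%:R * \sum_(i < s) \sum_(j < p) sigma ^+ 2))
  + a ^+ 3 * L ^+ 2 / 2 * (\sum_(i < s) \sum_(j < p)
    (p%:R * (\sum_(i' < s | (i' < i)%N) \sum_(j' < p) sigma ^+ 2) +
     j%:R * \sum_(j' < p | (j' < j)%N) sigma ^+ 2)))).
  apply: mean_leD; first apply: mean_leD.
  - apply: mean_leZ => //; apply: mean_le_sum => i _; apply: mean_le_sum => j _.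
    exact: mean_block_noise.
  - apply: mean_leZ; first by rewrite divr_ge0.
    apply: mean_leZ; first exact: sqr_ge0.
    apply: mean_leZ => //; apply: mean_le_sum => i _; apply: mean_le_sum => j _.
    exact: mean_block_sqr.
  - apply: mean_leZ; first by rewrite divr_ge0// mulr_ge0 ?sqr_ge0// exprn_ge0.
    apply: mean_le_sum => i _; apply: mean_le_sum => j _; apply: mean_leD.
      apply: mean_leZ => //; apply: mean_le_sum => i' _; apply: mean_le_sum => j' _.
      exact: mean_block_sqr.
    by apply: mean_leZ => //; apply: mean_le_sum => j' _; exact: mean_block_sqr.
rewrite big1 ?mulr0 ?add0r; last by move=> i _; rewrite big1.
rewrite lerD//; first by rewrite !sumr_const !card_ord !mulr_natl.
rewrite ler_wpM2l// ?sum_displacement_le ?sqr_ge0//.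
by rewrite divr_ge0// mulr_ge0 ?sqr_ge0// exprn_ge0.
Qed.

Lemma sum_sqr_grad_le w :
  a * p%:R / 2 * \sum_(t < T) sqr_grad t w <=
  F (xs 0 0 0 w) - inf (range F) + \sum_(t < T) iteration_error t w.
Proof.
have p_gt0 : (0 < p)%N by rewrite p_def.
have step (t : 'I_T) : F (xs t.+1 0 0 w) + a * p%:R / 2 * sqr_grad t w <=
    F (xs t 0 0 w) + iteration_error t w.
  have := @block_iteration_descent R n q s p f L a blk m (tau t w) (fun i j => sel t i w j)
    (fun i j => xs t i j w) (G t w) f_diff L_ge0 f_smooth a_ge0 p_def p_gt0
    (run_frequency (run w) t) (run_update (run w) t) (run_next_block (run w) t).
  by rewrite (run_next_iter (run w)) /iteration_error !addrA.
have telescope k : (k <= T)%N ->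
    F (xs k 0 0 w) + a * p%:R / 2 * \sum_(t < T | (t < k)%N) sqr_grad t w <=
    F (xs 0 0 0 w) + \sum_(t < T | (t < k)%N) iteration_error t w.
  elim: k => [_|k IH kT]; first by rewrite !sum_ord_lt0 mulr0.
  rewrite !(sum_ord_ltS (Ordinal kT)) /=.
  have := IH (ltnW kT); have := step (Ordinal kT) => /=.
  lra.
have := telescope T (leqnn T); rewrite !sum_ord_ltn.
(* The last value left by telescoping is replaced by the infimum. *)
have : inf (range F) <= F (xs T 0 0 w) by apply: ge_inf => //; exists (xs T 0 0 w).
lra.
Qed.

Let coord_measurable_outer (t : 'I_T) : coord_measurable (xs t 0 0).
Proof.
apply: (outer_iterate_measurable (xi := xi) g_diff (g_measurable g_int) run).
  exact: (init_measurable run_data).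
move=> t' i j _; split.
- exact: (tau_measurable run_data).
- exact: (sel_measurable run_data).
- exact: measurable_funP.
Qed.

Lemma sqr_grad_measurable (d0 : measure_display) (W : measurableType d0)
    (H : W -> 'rV[R]_n) :
  coord_measurable H -> measurable_fun setT (fun w => enorm (grad F (H w)) ^+ 2).
Proof.
move=> mH; under eq_fun do rewrite sqr_enorm.
by apply: measurable_sum => c; apply: measurable_funX; exact: grad_weighted_sum_measurable.
Qed.

(** The telescoped bound is divided by a p / 2 and by T, then integrated. The left side is
    non-negative, so its measurability suffices for the comparison. *)
Lemma integral_average_le (e : R) : 0 < a ->
  mean_le P (fun w => F (xs 0 0 0 w) - inf (range F)) e ->
  (\int[P]_w (T%:R^-1 * \sum_(t < T) sqr_grad t w)%:E <=
    (T%:R^-1 * (2 / (a * p%:R)) * (e + T%:R *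
      (L / 2 * (a ^+ 2 * (p%:R * (s%:R * (p%:R * sigma ^+ 2)))) +
       a ^+ 3 * L ^+ 2 / 2 * (2 / 3 * p%:R ^+ 3 * s%:R ^+ 3 * sigma ^+ 2))))%:E)%E.
Proof.
move=> a_gt0 me.
have p_gt0 : 0 < p%:R :> R by rewrite ltr0n p_def.
have ap : 0 <= T%:R^-1 * (2 / (a * p%:R)).
  by rewrite mulr_ge0// divr_ge0// mulr_ge0.
set K := L / 2 * _ + _.
have sum_error : mean_le P (fun w => \sum_(t < T) iteration_error t w) (\sum_(t < T) K).
  by apply: mean_le_sum => t _; exact: mean_iteration_error.
have [i H] := mean_leZ ap (mean_leD me sum_error).
have KE : \sum_(t < T) K = T%:R * K by rewrite sumr_const card_ord mulr_natl.
rewrite -KE; apply: le_trans H; apply: ge0_le_integral => //.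
- move=> w _; rewrite lee_fin mulr_ge0// sumr_ge0// => t _; exact: sqr_ge0.
- apply/measurable_EFinP; apply: measurable_funM => //; apply: measurable_sum => t.
  by apply: sqr_grad_measurable; exact: coord_measurable_outer.
- exact: (measurable_int P i).
- move=> w _; rewrite lee_fin -mulrA ler_wpM2l//.
  rewrite -ler_pdivrMl ?divr_gt0 ?mulr_gt0//.
  by apply: le_trans _ (sum_sqr_grad_le w); rewrite invf_div.
Qed.

(** Freezing again, with the whole run as the past and the output index as the sample: integrating
    over the uniform index leaves the average over t. *)
Lemma integral_uniform_index (tbar : Omega -> 'I_T) :
  uniform_output_index P (xs 0%N 0%N 0%N) xi tau sel tbar ->
  (\int[P]_w (sqr_grad (tbar w) w)%:E =
    \int[P]_w (T%:R^-1 * \sum_(t < T) sqr_grad t w)%:E)%E.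
Proof.
move=> output; pose U := gens setT setT setT.
(* 'I_T carries no sigma-algebra, nat carries the discrete one. *)
pose index w := nat_of_ord (tbar w).
have mindex : measurable_fun setT index.
  move=> _ B _; rewrite setTI.
  exact: (measurable_finite_preimage (@nat_of_ord T @^-1` B) (index_measurable output)).
pose idx : {mfun Omega >-> nat} := HB.pack index (isMeasurableFun.Build _ _ _ _ _ mindex).
have coordU (t : 'I_T) : coord_measurable (W := g_sigma_algebraType U) (xs t 0 0).
  apply: (outer_iterate_measurable (W := g_sigma_algebraType U) (xi := xi) g_diff
    (g_measurable g_int) run).
    exact: init_coord_measurable.
  by move=> t' i' j' _; exact: generators_step_measurable.
(* The indicators select the summand of the drawn index, which separates the dependence on the run
   from that on the index. *)
pose h (u : g_sigma_algebraType U * nat) : R :=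
  \sum_(t < T) sqr_grad t u.1 * \1_[set nat_of_ord t] u.2.
have h0 u : 0 <= h u.
  by apply: sumr_ge0 => t _; rewrite mulr_ge0// sqr_ge0.
have mh : measurable_fun setT h.
  apply: measurable_sum => t; apply: measurable_funM.
    apply: (measurableT_comp (f := fun w : g_sigma_algebraType U => sqr_grad t w) (g := fst)).
      by apply: sqr_grad_measurable; exact: coordU.
    exact: measurable_fst.
  apply: (measurableT_comp (f := \1_[set nat_of_ord t] : nat -> R) (g := snd)).
    exact: measurable_indic.
  exact: measurable_snd.
have hE w : h (w, idx w) = sqr_grad (tbar w) w.
  rewrite /h (bigD1 (tbar w))//= indicE mem_set// mulr1 big1 ?addr0// => t tw.
  rewrite indicE memNset ?mulr0//= /index => /ord_inj E.
  by rewrite E eqxx in tw.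
have lawE (t : 'I_T) : distribution P idx [set nat_of_ord t] = (T%:R^-1)%:E.
  rewrite -(index_uniform output t); congr (P _).
  by apply/seteqP; split => v /=; [exact: ord_inj|move=> <-].
under eq_integral do rewrite -hE.
rewrite (@ge0_integral_frozen _ _ _ _ P _ (distribution P idx) U idx _ _ _ (EFin \o h))//.
- apply: eq_integral => w _.
  under eq_integral do rewrite /= /h /= -sumEFin.
  rewrite ge0_integral_sum//.
  + rewrite mulr_sumr -sumEFin; apply: eq_bigr => t _.
    under eq_integral do rewrite EFinM.
    rewrite ge0_integralZl_EFin ?sqr_ge0//.
    rewrite integral_indic// setIT muleC [RHS]EFinM; congr (_ * _)%E.
    exact: lawE.
  + by move=> t k _; rewrite lee_fin mulr_ge0// sqr_ge0.
- exact: (run_generators_measurable run_data).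
- move=> A B UA [C _ <-]; apply: (index_independent output) => //.
  by exists (@nat_of_ord T @^-1` C).
- exact/measurable_EFinP.
Qed.

End expected_run.

(** * The bound for the step size 1/sqrt(T) *)

Theorem theorem3p1
  (R : realType) (n q s p T : nat)
  (d d' : measure_display) (Omega : measurableType d) (P : probability Omega R)
  (Xi : measurableType d') (mu : probability Xi R)
  (f : 'I_q -> 'rV[R]_n -> R) (g : 'I_q -> 'rV[R]_n -> Xi -> R)
  (blk : 'I_n -> 'I_s) (m : 'I_q -> nat) (L sigma : R)
  (tau : 'I_T -> Omega -> {perm 'I_s})
  (sel : 'I_T -> 'I_s -> Omega -> {ffun 'I_p -> 'I_q})
  (xi : 'I_T -> 'I_s -> 'I_p -> {mfun Omega >-> Xi})
  (xs : nat -> nat -> nat -> Omega -> 'rV[R]_n)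
  (tbar : Omega -> 'I_T)
  (s_ge1 : (1 <= s)%N) (T_ge1 : (1 <= T)%N)
  (p_def : p = (\sum_(k < q) m k)%N) (p_ge1 : (1 <= p)%N)
  (f_C1 : forall k, continuously_differentiable (f k))
  (g_diff : forall k z x, differentiable (g k ^~ z) x)
  (g_int : forall k x, mu.-integrable setT (fun z => (g k x z)%:E))
  (f_def : forall k x, (f k x)%:E = ('E_mu[g k x])%E)
  (L_gt0 : 0 < L)
  (f_smooth : forall k x x',
     enorm (grad (f k) x - grad (f k) x') <= L * enorm (x - x'))
  (F_lbound : has_lbound (range (weighted_sum m f)))
  (sigma_ge0 : 0 <= sigma)
  (g_unbiased : forall k x c,
     ('E_mu[(fun z => grad (g k ^~ z) x 0 c)%R])%E = (grad (f k) x 0 c)%:E)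
  (g_bounded : forall k x,
     ('E_mu[(fun z => enorm (grad (g k ^~ z) x) ^+ 2)%R] <= (sigma ^+ 2)%:E)%E)
  (run_data : random_run_data P mu (xs 0%N 0%N 0%N) xi tau sel)
  (run : forall w : Omega,
     block_smoo_run g blk (fun=> 1 / Num.sqrt T%:R) m
       (fun t => tau t w) (fun t i => sel t i w) (fun t i j => xi t i j w)
       (fun t i j => xs t i j w))
  (output : uniform_output_index P (xs 0%N 0%N 0%N) xi tau sel tbar) :
  ('E_P[(fun w =>
      enorm (grad (weighted_sum m f) (xs (tbar w) 0%N 0%N w)) ^+ 2)%R]
   <= (2 / Num.sqrt T%:R)%:E *
      ('E_P[(fun w => weighted_sum m f (xs 0%N 0%N 0%N w)
                      - inf (range (weighted_sum m f)))%R]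
       + (L * sigma ^+ 2 * p%:R ^+ 2 * (s%:R + L * s%:R ^+ 3 / 3))%:E))%E.

Proof.
set F := weighted_sum m f; set r := Num.sqrt T%:R.
have r1 : 1 <= r by rewrite -sqrtr1 ler_wsqrtr// ler1n.
have r0 : 0 < r by exact: lt_le_trans r1.
have r2 : r ^+ 2 = T%:R by rewrite sqr_sqrtr.
have a0 : 0 <= 1 / r by rewrite divr_ge0// ltW.
have sum_m : (0 < \sum_k m k)%N by rewrite -p_def.
have f_diff k x : differentiable (f k) x := (f_C1 k).1 x.
have F_cont : continuous F.
  move=> x; apply: differentiable_continuous; rewrite /F weighted_sumE.
  by apply: differentiable_sum => k; apply: differentiableZ.
pose F0 w := F (xs 0 0 0 w) - inf (range F).
have F0_ge0 w : 0 <= F0 w by rewrite subr_ge0; apply: ge_inf => //; exists (xs 0 0 0 w).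
have mF0 : measurable_fun setT F0.
  apply: measurable_funB => //; apply: (continuous_measurable_comp F_cont).
  exact: (init_measurable run_data).
have -> : ('E_P[(fun w => (enorm (grad F (xs (tbar w) 0 0 w)) ^+ 2)%R)] =
    \int[P]_w (T%:R^-1 * \sum_(t < T) enorm (grad F (xs t 0 0 w)) ^+ 2)%:E)%E.
  rewrite unlock.
  exact: (integral_uniform_index f_C1 g_diff g_int run_data run output).
have E0_ge0 : (0 <= 'E_P[F0])%E by exact: expectation_ge0.
(* The initial gap is non-negative but may have infinite mean; then the right-hand side is infinite.
   Otherwise its mean is a real number [e]. *)
have [Ey|Efin] := eqVneq ('E_P[F0])%E (+oo%E).
  rewrite Ey addye// gt0_muley ?leey// lte_fin divr_gt0//.
have [e Ee] : exists e : R, ('E_P[F0] = e%:E)%E.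
  by case: ('E_P[F0])%E E0_ge0 Efin => [e _ _|//|//]; exists e.
have me : mean_le P F0 e.
  split; last by rewrite -Ee unlock.
  apply/integrableP; split; first exact/measurable_EFinP.
  under eq_integral do rewrite /= ger0_norm//.
  by move: Ee; rewrite unlock => ->; exact: ltry.
have e0 : 0 <= e by rewrite -lee_fin -Ee.
have r_gt0 : 0 < 1 / r by rewrite divr_gt0.
have := integral_average_le f_C1 g_diff g_int g_unbiased g_bounded sum_m run_data run
  s_ge1 p_def (ltW L_gt0) f_smooth F_lbound a0 r_gt0 me.
move=> H; apply: le_trans H _; rewrite Ee -EFinD -EFinM lee_fin.
have s1 : 1 <= s%:R :> R by rewrite ler1n.
have p1 : 1 <= p%:R :> R by rewrite ler1n.
have S0 : 0 < s%:R :> R by exact: lt_le_trans s1.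
have N0 : 0 < p%:R :> R by exact: lt_le_trans p1.
rewrite -/r -r2; set S := s%:R in s1 S0 *; set N := p%:R in p1 N0 *; set v := sigma ^+ 2.
have v0 : 0 <= v by exact: sqr_ge0.
(* With step size 1/r and T = r^2, the noise-variance term loses its dependence on T and the drift
   term keeps a factor 1/r. *)
rewrite [leLHS](_ : _ = 2 / r *
    (e / N + L * S * v * N / 2 + L ^+ 2 * N ^+ 2 * S ^+ 3 * v / 3 / r)); last first.
  by field; rewrite !gt_eqF//.
apply: ler_wpM2l; first by rewrite divr_ge0// ltW.
have LSv : 0 <= L * S * v by rewrite !mulr_ge0// ltW.
have LNSv : 0 <= L ^+ 2 * N ^+ 2 * S ^+ 3 * v / 3.
  apply: divr_ge0 => //; apply: mulr_ge0 => //; apply: mulr_ge0; last exact/exprn_ge0/ltW.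
  by apply: mulr_ge0; exact: sqr_ge0.
(* The three terms are smaller than the claimed ones by the factors 1/N, 1/(2N) and 1/r, which are
   given up using N >= 1 and r >= 1. *)
have h1 : e / N <= e by rewrite ler_pdivrMr// ler_peMr.
have h2 : L * S * v * N / 2 <= L * S * v * N ^+ 2.
  by rewrite -mulrA ler_wpM2l//; nra.
have h3 : L ^+ 2 * N ^+ 2 * S ^+ 3 * v / 3 / r <= L ^+ 2 * N ^+ 2 * S ^+ 3 * v / 3.
  by rewrite ler_pdivrMr// ler_peMr.
rewrite [leRHS](_ : _ = e + L * S * v * N ^+ 2 + L ^+ 2 * N ^+ 2 * S ^+ 3 * v / 3).
  by rewrite !lerD.
by field.
Qed.
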